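(* Let $P$ be a Markov counting process with intensity $\ell$ (satisfying the standing assumptions below). Assume that for some $\lambda\in\mathbb{R}$ $$\lim_{z\to+\infty}\sup_{t\in[0,1]}|\Xi_\ell(t,z)-\lambda|=0.$$ Then for every $\varepsilon>0$, $$\lim_{N\to+\infty}P^{0N}\Big(\sup_{t\in[0,1]}\Big|\tfrac1N X_t-\pi_\lambda(t)\Big|\ge\varepsilon\Big)=0.$$
   Context: $\Omega$ is the space of càdlàg step functions $\omega:[0,1]\to\mathbb{N}$ with finitely many jumps, all of amplitude $+1$, with no jump at $t=0$ or $t=1$; $X$ is the canonical process. A Markov counting process with intensity $\ell:[0,1]\times\mathbb{N}\to\mathbb{R}_+$ is a probability $P$ on $\Omega$ under which $t\mapsto X_t-X_0-\int_0^t\ell(r,X_{r^-})\,dr$ is a local martingale. Standing assumptions: (i) $t\mapsto\ell(t,z)$ is continuously differentiable on $[0,1]$ for each $z$; (ii) $(t,z)\mapsto\ell(t,z+1)-\ell(t,z)$ is globally bounded above and below; (iii) $\ell>0$ everywhere; the initial law of $P$ has full support on $\mathbb{N}$. $P^{0N}(\cdot)=P(\cdot\mid X_0=0,X_1=N)$. The reciprocal characteristic is $\Xi_\ell(t,z)=\partial_t\log\ell(t,z)+\ell(t,z+1)-\ell(t,z)$. $\pi_\lambda(t)=\frac{e^{\lambda t}-1}{e^{\lambda}-1}$ for $\lambda\neq0$ and $\pi_0(t)=t$. *)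

(* Defs.v *)
From HB Require Import structures.
From mathcomp Require Import all_boot all_order all_algebra.
From mathcomp Require Import all_classical all_reals all_analysis.
Set Implicit Arguments. Unset Strict Implicit. Unset Printing Implicit Defensive.
Import Order.TTheory GRing.Theory Num.Theory.
Import numFieldNormedType.Exports.
Local Open Scope classical_set_scope.
Local Open Scope ring_scope.

Section CountingPaths.
Variable R : realType.

(** The path space Omega.  A càdlàg step function [0,1] -> N with finitely
    many jumps, all of amplitude +1, none at t = 0 or t = 1, is determined by
    its initial value x0 and the strictly increasing finite list of its jump
    times, all in the open interval ]0,1[. *)
Definition valid_path (p : nat * seq R) : bool :=
  sorted <%R p.2 && all (fun s => (0 < s) && (s < 1)) p.2.

Definition path_t := {p : nat * seq R | valid_path p}.

Lemma valid_path0 : valid_path (0%N, [::]). Proof. by []. Qed.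

HB.instance Definition _ := Choice.on path_t.
HB.instance Definition _ :=
  isPointed.Build path_t (exist (fun p => valid_path p) (0%N, [::]) valid_path0).

(** Canonical process: X_t(w) = x0 + #{jump times <= t}  (right-continuous),
    and its left limit X_{t-}(w) = x0 + #{jump times < t}. *)
Definition Xt (t : R) (w : path_t) : nat :=
  ((sval w).1 + count (fun s : R => (s <= t)%R) (sval w).2)%N.
Definition Xtm (t : R) (w : path_t) : nat :=
  ((sval w).1 + count (fun s : R => (s < t)%R) (sval w).2)%N.

Definition cyl (t : R) : set (set path_t) :=
  [set A | exists s k, 0 <= s <= t /\ A = [set w | Xt s w = k]].

Definition Filt (t : R) : set (set path_t) := <<s cyl t >>.

End CountingPaths.

Definition Omega (R : realType) := g_sigma_algebraType (cyl (R:=R) 1).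

Section MarkovCounting.
Variable R : realType.
Local Notation Om := (Omega R).

Definition compensated (l : R -> nat -> R) (t : R) (w : Om) : R :=
  (Xt t w)%:R - (Xt 0 w)%:R
  - Rintegral lebesgue_measure `[0, t] (fun r => l r (Xtm r w)).

Definition stopping_time (tau : Om -> R) : Prop :=
  (forall w, 0 <= tau w) /\
  (forall t, 0 <= t <= 1 -> Filt (R:=R) t [set w | tau w <= t]).

Definition martingale (P : probability Om R) (N : R -> Om -> R) : Prop :=
  (forall t, 0 <= t <= 1 -> P.-integrable setT (fun w => (N t w)%:E)) /\
  (forall s t, 0 <= s -> s <= t -> t <= 1 -> forall A, Filt (R:=R) s A ->
     (\int[P]_(w in A) (N t w)%:E = \int[P]_(w in A) (N s w)%:E)%E).

(** N is a local martingale on [0,1]: there is a nondecreasing sequence of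
    stopping times tau_n, P-a.s. eventually >= 1 (i.e. tau_n "-> infinity"
    for the process on [0,1]), such that each stopped process is a martingale. *)
Definition local_martingale (P : probability Om R) (N : R -> Om -> R) : Prop :=
  exists tau : nat -> Om -> R,
    (forall n, stopping_time (tau n)) /\
    (forall n w, tau n w <= tau n.+1 w) /\
    {ae P, forall w, exists n, 1 <= tau n w} /\
    (forall n, martingale P (fun t w => N (Order.min t (tau n w)) w)).

Definition markov_counting (P : probability Om R) (l : R -> nat -> R) : Prop :=
  local_martingale P (compensated l).

Definition bridge_event (N : nat) : set Om :=
  [set w | Xt 0 w = 0%N /\ Xt 1 w = N].
Definition Pbridge (P : probability Om R) (N : nat) (A : set Om) : R :=
  fine (P (A `&` bridge_event N)) / fine (P (bridge_event N)).

Definition Xi (l dl : R -> nat -> R) (t : R) (z : nat) : R :=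
  dl t z / l t z + (l t z.+1 - l t z).

Definition pi_lam (lam t : R) : R :=
  if lam == 0 then t else (expR (lam * t) - 1) / (expR lam - 1).

Definition C1_on01 (l dl : R -> nat -> R) : Prop :=
  forall z,
    {within `[0, 1], continuous (fun t => dl t z)} /\
    (forall t, 0 <= t <= 1 ->
       (fun h => h^-1 * (l (t + h) z - l t z))
         @ within [set h | 0 <= t + h <= 1] (0 : R)^' --> dl t z).

End MarkovCounting.

(* Main.v *)
(** Under [X_0 = 0] the marginals [q_k(t) = P(A, X_t = k)], for an event [A] known
    at time [s], satisfy the forward equations [q_k' = l_(k-1) q_(k-1) - l_k q_k] on
    [[s, 1]].  These come from the local martingale property by summing
    [1_{X_r = k} (M_r' - M_r)] over finer and finer grids: this sum has mean zero, and
    for a fixed path it is eventually exact up to the mesh.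
    With [L_k(t) = int_0^t l(., k)], the functions [v_k = q_k exp(L_k)] satisfy
    [v_k' = w_k v_(k-1)] with [w_k = l_(k-1) exp(L_k - L_(k-1))], and
    [(log w_k)' = Xi(., k-1)].  As [Xi] is close to [lam], [w_k] is a constant times
    [exp(lam t)] up to a factor [exp(d_(k-1))], where [d_j = sup |Xi(., j) - lam|].
    Iterated integration then bounds the law of [X_s] under the bridge by
    [exp(2 sum_(j < N) d_j)] times the binomial law of parameters [N] and [pi_lam s].
    Since [sum_(j < N) d_j = o(N)] (Cesaro), this loses against the exponential
    Chernoff bound, so [X_s / N] is close to [pi_lam s]; monotonicity of the paths
    makes this uniform in [s]. *)
Require Import Defs.
From HB Require Import structures.
From mathcomp Require Import all_boot all_order all_algebra.
From mathcomp Require Import all_classical all_reals all_analysis.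
From mathcomp Require Import measurable_realfun ring lra.
Import Order.TTheory GRing.Theory Num.Theory.
Import numFieldNormedType.Exports.
Local Open Scope classical_set_scope.
Local Open Scope ring_scope.
Set Implicit Arguments.
Unset Strict Implicit.
Unset Printing Implicit Defensive.

(** The hypothesis is only a local martingale property, so neither a Markov property nor
    integrability of [X] is at hand. An arbitrary event [A] of [Filt s] replaces conditioning: the
    equations run on [[s, 1]] from [A = {X_0 = 0, X_s = m}] play the role of a transition
    probability. Localisation is removed last: the indicator of [X = k] keeps the error on
    [{tau < 1}] below a constant independent of [tau], and the quantity to be shown small does not
    involve [tau]. Starting from a single level makes the infinite system triangular, so it is
    solved level by level by comparison. In the quotient defining the bridge, the constants [l 0 j],
    the initial mass and the factor [exp(L_N(1))] cancel. The numerator takes the upper comparison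
    and the denominator the lower one, whence the 2 in the exponent. What remains are volumes of
    simplices measured in the clock [rho]; cutting the simplex over [[0, 1]] at time [s] produces
    the binomial law. *)

Section Paths.
Variable R : realType.
Implicit Types (w : path_t R) (r s t : R).

Lemma Xt_le s t w : s <= t -> (Xt s w <= Xt t w)%N.
Proof. by move=> st; rewrite leq_add2l; apply: sub_count => x /= /le_trans; apply. Qed.

Lemma Xtm_le_Xt r t w : r <= t -> (Xtm r w <= Xt t w)%N.
Proof. by move=> rt; rewrite leq_add2l; apply: sub_count => x /= /ltW/le_trans; apply. Qed.

Lemma Xt_le_Xtm s r w : s < r -> (Xt s w <= Xtm r w)%N.
Proof. by move=> sr; rewrite leq_add2l; apply: sub_count => x /= /le_lt_trans; apply. Qed.

(** Strict sorting makes the jump times distinct, so a window shorter than every gap between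
    neighbours contains at most one of them. If [t < s] the inequality is mere monotonicity. *)
Lemma count_sorted_gap (js : seq R) : sorted <%R js ->
  exists2 d : R, 0 < d & forall s t, t - s < d ->
    (count (fun x : R => (x <= t)%R) js <= (count (fun x : R => (x <= s)%R) js).+1)%N.
Proof.
elim: js => [|x js IH] /=; first by move=> _; exists 1.
move=> xjs; have [d d0 Hd] := IH (path_sorted xjs).
(* The jump following [x]; the default [x + 1] is arbitrary and serves when there is none. *)
pose y := head (x + 1) js.
have xy : x < y by rewrite /y; case: js xjs {IH Hd y} => [|z js] /=; [lra|case/andP].
have Hy t : t < y -> count (fun x : R => (x <= t)%R) js = 0%N.
  rewrite /y; case: js xjs {IH Hd y xy} => [//|z js] /= /andP[_ zjs] tz.
  rewrite leNgt tz /= add0n; apply/eqP; rewrite -leqn0 leqNgt -has_count; apply/hasPn => u uj.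
  by rewrite -ltNge (lt_trans tz)//; move: zjs; rewrite (path_sortedE (@lt_trans _ _)) => /andP[/allP/(_ _ uj)].
exists (Num.min d (y - x)); first by rewrite lt_min d0 subr_gt0.
move=> s t; rewrite lt_min => /andP[tsd tsx].
case: (leP x s) => xs; first by rewrite (leq_trans (leq_add (leq_b1 _) (Hd _ _ tsd))).
by rewrite Hy ?addn0 ?(leq_trans (leq_b1 _))//; lra.
Qed.

Lemma Xt_gap w : exists2 d : R, 0 < d & forall s t, t - s < d ->
  (Xt t w <= (Xt s w).+1)%N.
Proof.
have [js _] := andP (svalP w); have [d d0 Hd] := @count_sorted_gap (sval w).2 js.
by exists d => // s t /Hd; rewrite -addnS leq_add2l.
Qed.

Lemma Xt_right_cst t w : exists2 d : R, 0 < d & forall u, t <= u -> u < t + d ->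
  Xt u w = Xt t w.
Proof.
rewrite /Xt; elim: (sval w).2 => [|x js [d d0 IH]] /=; first by exists 1.
case: (leP x t) => xt.
  exists d => // u tu ud; have /addnI := IH u tu ud; rewrite (le_trans xt tu) => -> //.
exists (Num.min d (x - t)); first by rewrite lt_min d0 subr_gt0.
move=> u tu ud; have /andP[ud1 ud2] : (u < t + d) && (u < x).
  by move: ud; rewrite -ltrBlDl lt_min => /andP[? ?]; apply/andP; split; lra.
by have /addnI -> := IH u tu ud1; rewrite leNgt ud2.
Qed.

End Paths.

(** * Primitives and bounds on their increments *)

Section Primitive.
Variable R : realType.
Local Notation mu := (@lebesgue_measure R).
Implicit Types (f g : R -> R) (a b t : R).

Definition prim f t : R := Rintegral mu `[0, t] f.

(** The interval is open on the left because the left limit [Xtm r] is known to be at least [Xt a]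
    only when [a < r]. *)
Lemma prim_itv f a b : mu.-integrable `[0, 1] (EFin \o f) ->
  0 <= a -> a <= b -> b <= 1 -> prim f b - prim f a = Rintegral mu `]a, b] f.
Proof.
move=> fi a0 ab b1; apply: Rintegral_itvB; rewrite ?bnd_simp//.
by apply: (integrableS _ _ _ fi) => //; apply: subset_itvl; rewrite bnd_simp.
Qed.

Lemma prim_bounds f (lo hi : R) a b : mu.-integrable `[0, 1] (EFin \o f) ->
  0 <= a -> a <= b -> b <= 1 ->
  (forall r, a < r -> r <= b -> lo <= f r <= hi) ->
  lo * (b - a) <= prim f b - prim f a <= hi * (b - a).
Proof.
move=> fi a0 ab b1 H; rewrite prim_itv//.
have iab : mu.-integrable `]a, b] (EFin \o f).
  apply: (integrableS _ _ _ fi) => // x /=; rewrite !in_itv/= => /andP[ax xb].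
  by rewrite (le_trans a0 (ltW ax)) (le_trans xb b1).
have mab : fine (mu `]a, b]) = b - a.
  by rewrite lebesgue_measure_itv/= lte_fin; case: ltP => // ba; apply/eqP;
    rewrite eq_sym subr_eq0 eq_le ba ab.
have ic (c : R) : mu.-integrable `]a, b] (EFin \o cst c).
  apply: measurable_bounded_integrable => //=.
  - by rewrite lebesgue_measure_itv/=; case: ifP => _; rewrite -?EFinB ltry.
  - exact: bounded_cst.
rewrite -mab -!(@Rintegral_cst _ _ _ mu)//; apply/andP; split.
  apply: (le_Rintegral _ (ic lo) iab) => // x /=.
  by rewrite in_itv/= => /andP[/H h /h /andP[]].
apply: (le_Rintegral _ iab (ic hi)) => // x /=.
by rewrite in_itv/= => /andP[/H h /h /andP[]].
Qed.

Lemma eq_prim f g a b : mu.-integrable `[0, 1] (EFin \o f) ->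
  mu.-integrable `[0, 1] (EFin \o g) ->
  0 <= a -> a <= b -> b <= 1 -> (forall r, a < r -> r <= b -> f r = g r) ->
  prim f b - prim f a = prim g b - prim g a.
Proof.
move=> fi gi a0 ab b1 fg; rewrite !prim_itv//; apply: eq_Rintegral => r.
by rewrite inE/= in_itv/= => /andP[]; exact: fg.
Qed.

End Primitive.

(** * The intensity integrated along a path and at a fixed level *)

Section Rate.
Variables (R : realType) (l : R -> nat -> R) (C D : R).
Hypothesis lc : forall z, {within `[0, 1], continuous (l ^~ z)}.
Hypothesis l_gt0 : forall t z, 0 <= t <= 1 -> 0 < l t z.
Hypothesis C_ge0 : 0 <= C.
Hypothesis l_le : forall t z, 0 <= t <= 1 -> l t z <= D + C * z%:R.
Local Notation mu := (@lebesgue_measure R).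
Implicit Types (w : path_t R) (a b r t : R).

Lemma rate_integrable z : mu.-integrable `[0, 1] (EFin \o (l ^~ z)).
Proof. by apply: continuous_compact_integrable => //; exact: segment_compact. Qed.

(** A path has finitely many values on [[0, 1]], so the integrand is a finite sum of functions
    [l ^~ k], each times the indicator of a level set of a monotone function. The affine bound at
    level [Xt 1 w] makes it bounded. *)
Lemma path_rate_integrable w :
  mu.-integrable `[0, 1] (EFin \o (fun r => l r (Xtm r w))).
Proof.
apply: measurable_bounded_integrable => //=.
- by rewrite lebesgue_measure_itv/= lte01 ltry.
- pose g r := \sum_(k < (Xt 1 w).+1) l r k * (((Xtm r w)%:R : R) == k%:R)%:R.
  apply: (@eq_measurable_fun _ _ _ _ _ g) => [r|].
    rewrite inE/= in_itv/= => /andP[r0 r1]; rewrite /g.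
    have Xr : (Xtm r w < (Xt 1 w).+1)%N by rewrite ltnS Xtm_le_Xt.
    rewrite (bigD1 (Ordinal Xr))//= eqxx mulr1 big1 ?addr0// => i /eqP iX.
    rewrite eqr_nat; case: eqP; rewrite ?mulr0// => Xi.
    by exfalso; apply: iX; apply: val_inj.
  apply: measurable_sum => k; apply: measurable_funM.
    by apply: (subspace_continuous_measurable_fun _ (@lc k)); exact: measurable_itv.
  have -> : (fun x => (((Xtm x w)%:R : R) == k%:R)%:R) =
      \1_[set x | ((Xtm x w)%:R : R) == k%:R] :> (R -> R).
    apply/funext => x; rewrite indicE; congr (_%:R); congr nat_of_bool.
    by apply/idP/idP => [h|]; rewrite inE.
  apply: measurable_indic.
  have := @measurable_fun_eqr _ _ R setT (fun x : R => (Xtm x w)%:R) (cst k%:R).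
  have h1 : measurable_fun setT (fun x : R => (Xtm x w)%:R : R).
    apply: nondecreasing_measurable => // x y xy; rewrite ler_nat leq_add2l.
    by apply: sub_count => z /= /lt_le_trans; apply.
  move=> /(_ h1 (measurable_cst _) measurableT [set true] I).
  by rewrite setTI.
- exists (D + C * (Xt 1 w)%:R); split; rewrite ?num_real// => M DM r /=.
  rewrite in_itv/= => r01; rewrite ger0_norm ?(ltW (l_gt0 _ r01))//.
  apply: (le_trans (l_le _ r01)); apply: (le_trans _ (ltW DM)).
  rewrite lerD2l ler_wpM2l// ler_nat Xtm_le_Xt//.
  by case/andP: r01.
Qed.

Lemma path_prim_bounds w a b : 0 <= a -> a <= b -> b <= 1 ->
  0 <= prim (fun r => l r (Xtm r w)) b - prim (fun r => l r (Xtm r w)) a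
    <= (D + C * (Xt b w)%:R) * (b - a).
Proof.
move=> a0 ab b1; rewrite -[X in X <= _](mul0r (b - a)).
apply: prim_bounds => //; first exact: path_rate_integrable.
move=> r ar rb; have r01 : 0 <= r <= 1 by apply/andP; split; lra.
rewrite ltW ?l_gt0//=; apply: (le_trans (l_le _ r01)).
by rewrite lerD2l ler_wpM2l// ler_nat Xtm_le_Xt.
Qed.

Lemma rate_prim_bounds k a b : 0 <= a -> a <= b -> b <= 1 ->
  0 <= prim (l ^~ k) b - prim (l ^~ k) a <= (D + C * k%:R) * (b - a).
Proof.
move=> a0 ab b1; rewrite -[X in X <= _](mul0r (b - a)).
apply: prim_bounds => //; first exact: rate_integrable.
move=> r ar rb; have r01 : 0 <= r <= 1 by apply/andP; split; lra.
by rewrite ltW ?l_gt0//= l_le.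
Qed.

Lemma path_prim_cst w k a b : 0 <= a -> a <= b -> b <= 1 ->
  Xt a w = k -> Xt b w = k ->
  prim (fun r => l r (Xtm r w)) b - prim (fun r => l r (Xtm r w)) a =
  prim (l ^~ k) b - prim (l ^~ k) a.
Proof.
move=> a0 ab b1 Xa Xb; apply: eq_prim => //.
- exact: path_rate_integrable.
- exact: rate_integrable.
move=> r ar rb; congr l; apply/eqP; rewrite eqn_leq -{1}Xb -Xa.
by rewrite Xtm_le_Xt// Xt_le_Xtm.
Qed.

Lemma rate_prim_derive k t : 0 < t < 1 -> is_derive t 1 (prim (l ^~ k)) (l t k).
Proof.
move=> /andP[t0 t1].
have [] := @continuous_FTC1_closed _ (l ^~ k) 0 t 1 t1 (rate_integrable k) t0.
  apply: (within_continuous_continuous ltr01 (@lc k)).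
  by rewrite in_itv/= t0 t1.
by move=> dv <-; rewrite derive1E; exact: derivableP.
Qed.

End Rate.

(** * Riemann sums along a path *)

Section Grid.
Variable R : realType.

Definition grid (a b : R) (n i : nat) : R := a + (b - a) * (i%:R / n.+1%:R).

Lemma grid0 a b n : grid a b n 0 = a. Proof. by rewrite /grid mul0r mulr0 addr0. Qed.

Lemma gridn a b n : grid a b n n.+1 = b.
Proof. by rewrite /grid divff ?pnatr_eq0// mulr1; ring. Qed.

Lemma gridS a b n i : grid a b n i.+1 - grid a b n i = (b - a) / n.+1%:R.
Proof. by rewrite /grid -natr1; ring. Qed.

Lemma grid_ge a b n i : a <= b -> a <= grid a b n i.
Proof. by move=> ab; rewrite lerDl mulr_ge0 ?divr_ge0 ?subr_ge0. Qed.

Lemma grid_le a b n i : a <= b -> (i <= n.+1)%N -> grid a b n i <= b.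
Proof.
move=> ab iN; rewrite /grid -lerBrDl ler_piMr ?subr_ge0//.
by rewrite ler_pdivrMr ?ltr0Sn// mul1r ler_nat.
Qed.

Lemma grid_leS a b n i : a <= b -> grid a b n i <= grid a b n i.+1.
Proof. by move=> ab; rewrite -subr_ge0 gridS divr_ge0 ?subr_ge0. Qed.

End Grid.

Lemma sum_cst_div (R : numFieldType) (K c : R) n :
  \sum_(i < n.+1) K * (c / n.+1%:R) = K * c.
Proof.
by rewrite -mulr_sumr -mulr_sumr sumr_const card_ord -[_ *+ n.+1]mulr_natr
  mulVf ?mulr1 ?pnatr_eq0.
Qed.

Lemma one_subB_le (R : realDomainType) (x y c : R) : 0 <= x <= c -> 0 <= y <= c ->
  `|1 - x - (1 - y)| <= c.
Proof. by move=> /andP[? ?] /andP[? ?]; rewrite ler_norml; apply/andP; split; lra. Qed.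

(** With steps 0 or 1, each term is the increment of the indicator of [k < x i], and these
    telescope. *)
Lemma sum_unit_steps (R : realType) (x : nat -> nat) (k n : nat) :
  (forall i, (i < n)%N -> (x i <= x i.+1 <= (x i).+1)%N) ->
  \sum_(i < n) (x i == k)%:R * ((x i.+1)%:R - (x i)%:R) =
  (k < x n)%N%:R - (k < x 0)%N%:R :> R.
Proof.
elim: n => [|n IH] H; first by rewrite big_ord0 subrr.
rewrite big_ord_recr/= IH; last by move=> i iN; apply: H; rewrite ltnS ltnW.
have /andP[x1 x2] := H n (ltnSn n).
have [->|->] : x n.+1 = x n \/ x n.+1 = (x n).+1.
  by move: x2; rewrite leq_eqVlt ltnS => /orP[/eqP->|x2]; [right|left; apply/eqP; rewrite eqn_leq x1 x2].
  by rewrite subrr mulr0 addr0.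
rewrite -natr1 [_%:R + 1 - _]addrC addKr mulr1 ltnS.
by case: (ltngtP k (x n)) => _ /=; ring.
Qed.

Section PathSums.
Variables (R : realType) (l : R -> nat -> R) (C D : R).
Hypothesis lc : forall z, {within `[0, 1], continuous (l ^~ z)}.
Hypothesis l_gt0 : forall t z, 0 <= t <= 1 -> 0 < l t z.
Hypothesis C_ge0 : 0 <= C.
Hypothesis D_ge0 : 0 <= D.
Hypothesis l_le : forall t z, 0 <= t <= 1 -> l t z <= D + C * z%:R.
Variables (k : nat) (a b : R).
Hypotheses (a_ge0 : 0 <= a) (ab : a <= b) (b_le1 : b <= 1).
Implicit Types (w : path_t R) (n i : nat) (u : R).

(** A discrete stochastic integral against the compensated process stopped at [u], which will be the
    value of a stopping time. The indicator is read at the left end of each step, which makes the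
    mean vanish. *)
Definition mart_sum n u w : R := \sum_(i < n.+1)
  (Xt (grid a b n i) w == k)%:R *
  (compensated l (Order.min (grid a b n i.+1) u) w -
   compensated l (Order.min (grid a b n i) u) w).

(** The counterpart of [mart_sum] without stopping, with the jumps out of [k] summed exactly and the
    compensator of the path replaced by that of the constant level [k]. It is bounded, so its mean
    makes sense without localisation. *)
Definition forward_defect n w : R := (k < Xt b w)%N%:R - (k < Xt a w)%N%:R -
  \sum_(i < n.+1) (Xt (grid a b n i) w == k)%:R *
    (prim (l ^~ k) (grid a b n i.+1) - prim (l ^~ k) (grid a b n i)).

Local Notation p w := (prim (fun r => l r (Xtm r w))).

Lemma compensatedB w s t : compensated l t w - compensated l s w =
  ((Xt t w)%:R - (Xt s w)%:R) - (p w t - p w s).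
Proof. by rewrite /compensated /prim; ring. Qed.

Lemma minB_bounds (s t u : R) : 0 <= s -> s <= t -> t <= 1 -> 0 <= u ->
  [/\ 0 <= Order.min s u, Order.min s u <= Order.min t u, Order.min t u <= 1 &
      Order.min t u - Order.min s u <= t - s].
Proof. by move=> s0 st t1 u0; split; case: (leP s u); case: (leP t u); lra. Qed.

Lemma stopped_incr w s t u : s <= t ->
  0 <= ((Xt (Order.min t u) w)%:R - (Xt (Order.min s u) w)%:R : R)
    <= (Xt t w)%:R - (Xt s w)%:R.
Proof.
move=> st; case: (leP s u) => su; case: (leP t u) => tu.
- by rewrite subr_ge0 ler_nat Xt_le//=.
- by rewrite subr_ge0 ler_nat Xt_le//= lerD2r ler_nat Xt_le// ltW.
- by exfalso; lra.
- by rewrite subrr lexx subr_ge0 ler_nat Xt_le.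
Qed.

Lemma stopped_prim w s t u : 0 <= s -> s <= t -> t <= 1 -> 0 <= u ->
  0 <= p w (Order.min t u) - p w (Order.min s u)
    <= (D + C * (Xt (Order.min t u) w)%:R) * (t - s).
Proof.
move=> s0 st t1 u0; have [h1 h2 h3 h4] := minB_bounds s0 st t1 u0.
have /andP[-> /= h] := path_prim_bounds lc l_gt0 C_ge0 l_le w h1 h2 h3.
by apply: (le_trans h); rewrite ler_wpM2l// addr_ge0// mulr_ge0.
Qed.

Let ba1 : b - a <= 1.
Proof. by rewrite lerBlDr (le_trans b_le1)// lerDl. Qed.

(** Level [k + 1] and not [k]: a path at [k] at the start of a fine step may be at [k + 1] at its
    end. *)
Let K := D + C * k.+1%:R.

Let K_ge0 : 0 <= K. Proof. by rewrite addr_ge0// mulr_ge0. Qed.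

Let g n i := grid a b n i.

Let g01 n i : (i < n.+1)%N -> [/\ 0 <= g n i, g n i <= g n i.+1 & g n i.+1 <= 1].
Proof.
move=> iN; split; first exact: le_trans a_ge0 (grid_ge _ _ ab).
  exact: grid_leS.
exact: le_trans (grid_le ab iN) b_le1.
Qed.

Let mesh n : 0 <= (b - a) / n.+1%:R. Proof. by rewrite divr_ge0 ?subr_ge0. Qed.

Lemma rate_incr_le n i : (i < n.+1)%N ->
  0 <= prim (l ^~ k) (g n i.+1) - prim (l ^~ k) (g n i) <= K * ((b - a) / n.+1%:R).
Proof.
move=> /g01[h1 h2 h3]; have /andP[-> /= h] := rate_prim_bounds lc l_gt0 l_le k h1 h2 h3.
apply: (le_trans h); rewrite gridS ler_wpM2r// lerD2l ler_wpM2l// ler_nat//.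
Qed.

Lemma forward_defect_le n w : `|forward_defect n w| <= 1 + K.
Proof.
rewrite /forward_defect; apply: (le_trans (ler_normB _ _)); apply: lerD.
  by case: (_ < _)%N; case: (_ < _)%N; rewrite ?subrr ?subr0 ?sub0r ?normrN ?normr0 ?normr1 ?ler01.
apply: (le_trans (ler_norm_sum _ _ _)).
apply: (@le_trans _ _ (\sum_(i < n.+1) K * ((b - a) / n.+1%:R))).
  apply: ler_sum => i _; have /andP[h0 h1] := rate_incr_le (ltn_ord i).
  rewrite normrM (ger0_norm h0) normr_nat; apply: le_trans h1.
  by rewrite ler_piMl// lern1 leq_b1.
by rewrite sum_cst_div ler_piMr.
Qed.

(** Once the indicators are bounded by 1, the increments of [X] and of its compensator are
    nonnegative and telescope. The bound is free of [n] and asks nothing of the mesh, as domination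
    requires. *)
Lemma mart_sum_le n u w : 0 <= u -> `|mart_sum n u w| <=
  (Xt (Order.min b u) w)%:R + (D + C * (Xt (Order.min b u) w)%:R).
Proof.
move=> u0; apply: (le_trans (ler_norm_sum _ _ _)).
set y := fun i => (Xt (Order.min (g n i) u) w)%:R + p w (Order.min (g n i) u).
apply: (@le_trans _ _ (\sum_(0 <= i < n.+1) (y i.+1 - y i))).
  rewrite big_mkord; apply: ler_sum => i _.
  have [h1 h2 h3] := g01 (ltn_ord i).
  have /andP[s1 _] := stopped_incr w u h2.
  have /andP[s2 _] := stopped_prim w h1 h2 h3 u0.
  rewrite normrM normr_nat compensatedB -/(g n i) -/(g n i.+1).
  apply: (@le_trans _ _ (`|(Xt (Order.min (g n i.+1) u) w)%:R -
     (Xt (Order.min (g n i) u) w)%:R - (p w (Order.min (g n i.+1) u) - p w (Order.min (g n i) u))|)).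
    by rewrite ler_piMl// lern1 leq_b1.
  apply: (le_trans (ler_normB _ _)); rewrite !ger0_norm//.
  by rewrite /y; lra.
rewrite telescope_sumr// /y /g gridn grid0.
have /andP[_ h] := stopped_prim w a_ge0 ab b_le1 u0.
have : (D + C * (Xt (Order.min b u) w)%:R) * (b - a) <= D + C * (Xt (Order.min b u) w)%:R.
  by rewrite ler_piMr ?addr_ge0 ?mulr_ge0//; lra.
have : 0 <= (Xt (Order.min a u) w)%:R :> R by [].
lra.
Qed.

Section FineGrid.
Variables (n : nat) (w : path_t R).
Hypothesis gap : forall s t : R, t - s <= (b - a) / n.+1%:R -> (Xt t w <= (Xt s w).+1)%N.

Let step i : (i < n.+1)%N -> (Xt (g n i) w <= Xt (g n i.+1) w <= (Xt (g n i) w).+1)%N.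
Proof. by move=> iN; rewrite Xt_le ?grid_leS//= gap// gridS. Qed.

Let jumps : \sum_(i < n.+1) (Xt (g n i) w == k)%:R *
    ((Xt (g n i.+1) w)%:R - (Xt (g n i) w)%:R) =
  (k < Xt b w)%N%:R - (k < Xt a w)%N%:R :> R.
Proof. by rewrite (@sum_unit_steps _ (fun i => Xt (g n i) w))//= /g gridn grid0. Qed.

Let jumps01 : 0 <= ((k < Xt b w)%N%:R - (k < Xt a w)%N%:R : R) <= 1.
Proof.
have h : (Xt a w <= Xt b w)%N by apply: Xt_le.
case: (ltnP k (Xt a w)) => h1; first by rewrite (leq_trans h1 h) subrr lexx ler01.
by case: (_ < _)%N; rewrite subr0 lexx ler01.
Qed.

(* Both sums agree on every step without a jump, and at most one step has a jump
   out of [k]. *)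
Lemma forward_defect_mart_sum u : 1 <= u ->
  `|forward_defect n w - mart_sum n u w| <= K * ((b - a) / n.+1%:R).
Proof.
move=> u1; rewrite /forward_defect -jumps /mart_sum -sumrB -sumrB.
apply: (le_trans (ler_norm_sum _ _ _)).
apply: (@le_trans _ _ (\sum_(i < n.+1) ((Xt (g n i) w == k)%:R *
    ((Xt (g n i.+1) w)%:R - (Xt (g n i) w)%:R)) * (K * ((b - a) / n.+1%:R)))); last first.
  rewrite -mulr_suml jumps ler_piMl//; first by rewrite mulr_ge0.
  by case/andP: jumps01.
apply: ler_sum => i _; have [h1 h2 h3] := g01 (ltn_ord i).
rewrite compensatedB -/(g n i) -/(g n i.+1) !min_l; [|lra|lra].
case: eqP => [Xk|_]; rewrite ?mul0r ?subrr ?normr0// !mul1r.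
have /andP[s1 s2] := step (ltn_ord i).
have /andP[r1 r2] := rate_incr_le (ltn_ord i).
have /andP[q1 q2] := path_prim_bounds lc l_gt0 C_ge0 l_le w h1 h2 h3.
move: s1 s2; rewrite leq_eqVlt => /orP[/eqP Xe _|lt1 lt2].
  have Xk' : Xt (g n i.+1) w = k by rewrite -Xe.
  rewrite -Xe subrr mul0r (path_prim_cst lc l_gt0 C_ge0 l_le h1 h2 h3 Xk Xk').
  by rewrite (_ : _ - _ - _ = 0) ?normr0//; ring.
have Xe : Xt (g n i.+1) w = k.+1 by apply/eqP; rewrite eqn_leq -Xk lt1 lt2.
(* A jump out of [k]: the unit increments cancel, and what is left is the difference of two
   compensator increments between 0 and [K] times the mesh. *)
rewrite Xe Xk -natr1 (_ : k%:R + 1 - k%:R = 1); last by ring.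
rewrite mul1r; move: q2; rewrite Xe gridS -/K => q2.
by apply: one_subB_le; rewrite ?r1 ?q1.
Qed.

(** If [u < 1] the stopped sum may miss the jump out of [k], and only boundedness survives. The
    constant depends neither on [u] nor on the path. *)
Lemma forward_defect_mart_sum_le u : 0 <= u ->
  `|forward_defect n w - mart_sum n u w| <= 2 * (1 + K).
Proof.
move=> u0; apply: (le_trans (ler_normB _ _)).
suff : `|mart_sum n u w| <= 1 + K by have := forward_defect_le n w; lra.
apply: (le_trans (ler_norm_sum _ _ _)).
apply: (@le_trans _ _ (\sum_(i < n.+1) ((Xt (g n i) w == k)%:R *
    ((Xt (g n i.+1) w)%:R - (Xt (g n i) w)%:R) + (K * ((b - a) / n.+1%:R))))); last first.
  rewrite big_split/= jumps; apply: lerD; first by case/andP: jumps01.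
  by rewrite sum_cst_div ler_piMr.
apply: ler_sum => i _; have [h1 h2 h3] := g01 (ltn_ord i).
rewrite compensatedB -/(g n i) -/(g n i.+1).
case: eqP => [Xk|_]; last by rewrite !mul0r normr0 add0r mulr_ge0.
have /andP[s1 s2] := step (ltn_ord i).
have /andP[t1 t2] := stopped_incr w u h2.
have /andP[q1 q2] := stopped_prim w h1 h2 h3 u0.
rewrite !mul1r; apply: (le_trans (ler_normB _ _)); rewrite !ger0_norm//.
apply: lerD => //; apply: (le_trans q2); rewrite gridS ler_wpM2r// lerD2l ler_wpM2l// ler_nat.
by rewrite (leq_trans _ (_ : Xt (g n i.+1) w <= _)%N) -?Xk// Xt_le// ge_min lexx.
Qed.

End FineGrid.

End PathSums.

(** * An integrable bound for the stopped path *)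

Section Domination.
Variables (R : realType) (l : R -> nat -> R) (C D : R).
Hypothesis lc : forall z, {within `[0, 1], continuous (l ^~ z)}.
Hypothesis l_gt0 : forall t z, 0 <= t <= 1 -> 0 < l t z.
Hypothesis C_ge0 : 0 <= C.
Hypothesis D_ge0 : 0 <= D.
Hypothesis l_le : forall t z, 0 <= t <= 1 -> l t z <= D + C * z%:R.

(* On a step of length at most [1 / (2 C)], the increment of the compensator is at
   most [D + X / 2], which is absorbed on the left; [M] stands for the compensated
   process, whose values on the grid are integrable while [X] is not known to be. *)
Fixpoint gronwall_bound (M : R -> R) (m j : nat) : R :=
  if j is j'.+1 then 2 * (gronwall_bound M m j' + `|M (grid 0 1 m j)| +
    `|M (grid 0 1 m j')| + D) else 0.

Lemma stopped_le_gronwall m (w : path_t R) (u : R) : 2 * C <= m.+1%:R -> 0 <= u ->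
  Xt 0 w = 0%N ->
  (Xt (Order.min 1 u) w)%:R <=
    gronwall_bound (fun t => compensated l (Order.min t u) w) m m.+1.
Proof.
move=> Cm u0 X0; rewrite -[X in Order.min X _](gridn 0 1 m).
have : (m.+1 <= m.+1)%N by [].
elim: {-2}m.+1 => [_|j IH jm]; first by rewrite grid0 min_l//= X0.
have {}IH := IH (ltnW jm).
have h1 : 0 <= grid 0 1 m j :> R by apply: grid_ge.
have h2 : grid 0 1 m j <= grid 0 1 m j.+1 :> R by apply: grid_leS.
have h3 : grid 0 1 m j.+1 <= 1 :> R by apply: grid_le.
have /andP[_] := stopped_prim lc l_gt0 C_ge0 D_ge0 l_le w h1 h2 h3 u0.
have := compensatedB l w (Order.min (grid 0 1 m j) u) (Order.min (grid 0 1 m j.+1) u).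
rewrite gridS subr0 /=.
set Mj := compensated _ _ _; set Mi := compensated _ _ _.
set y := (Xt (Order.min (grid 0 1 m j.+1) u) w)%:R.
have : (D + C * y) * (1 / m.+1%:R) <= D + y / 2.
  rewrite mul1r ler_pdivrMr ?ltr0Sn//.
  have : 1 <= m.+1%:R :> R by rewrite ler1n.
  have : 0 <= y by [].
  move=> y0 m1; have := mulr_ge0 D_ge0 (_ : 0 <= m.+1%:R - 1).
  rewrite subr_ge0 => /(_ m1); have := mulr_ge0 y0 (_ : 0 <= m.+1%:R - 2 * C).
  by rewrite subr_ge0 => /(_ Cm); lra.
have := ler_norm Mj; have := ler_norm (- Mi); rewrite normrN.
move: IH; clearbody Mj Mi y; move: (gronwall_bound _ _ _) ((D + C * y) * _) `|Mj| `|Mi|.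
move: (Xt _ w)%:R (prim _ _) (prim _ _) => x p' p G c nj ni.
by clear; lra.
Qed.

End Domination.

(** * Real-valued integration under a probability *)

Lemma fine_probability_le d (T : measurableType d) (R : realType) (P : probability T R)
  (A B : set T) : measurable A -> measurable B -> A `<=` B -> fine (P A) <= fine (P B).
Proof.
by move=> mA mB AB; rewrite fine_le ?fin_num_measure//; apply: le_measure; rewrite ?inE.
Qed.

Section RealIntegrable.
Context d (T : measurableType d) (R : realType) (P : probability T R).
Variables (A : set T) (mA : measurable A).
Implicit Types (f g : T -> R) (B : set T).
Local Notation itg f := (P.-integrable A (EFin \o f)).

Lemma integrable_cstR (c : R) : itg (fun=> c).
Proof. exact: finite_measure_integrable_cst. Qed.

Lemma integrable_addR f g : itg f -> itg g -> itg (fun x => f x + g x).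
Proof. by move=> fi gi; exact: (integrableD mA fi gi). Qed.

Lemma integrable_subR f g : itg f -> itg g -> itg (fun x => f x - g x).
Proof. by move=> fi gi; exact: (integrableB mA fi gi). Qed.

Lemma integrable_scaleR (c : R) f : itg f -> itg (fun x => c * f x).
Proof. by move=> fi; exact: (integrableZl mA c fi). Qed.

Lemma integrable_normR f : itg f -> itg (fun x => `|f x|).
Proof. by move=> fi; exact: (integrable_abse fi). Qed.

Lemma integrable_indicR B f : measurable B -> itg f -> itg (fun x => \1_B x * f x).
Proof.
move=> mB fi; apply: (integrableMr mA (h := \1_B) _ _ fi); first exact: measurable_indic.
exists 1; split; rewrite ?num_real// => M M1 x _ /=; rewrite indicE normr_nat.
by rewrite (le_trans _ (ltW M1))// lern1 leq_b1.
Qed.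

Lemma integrable_sumR n (F : nat -> T -> R) : (forall i, (i < n)%N -> itg (F i)) ->
  itg (fun x => \sum_(i < n) F i x).
Proof.
elim: n => [|n IH] H.
  by apply: (@eq_integrable _ _ _ _ _ _ (EFin \o fun=> 0)) (integrable_cstR 0) => // x _ /=; rewrite big_ord0.
apply: (@eq_integrable _ _ _ _ _ _ (EFin \o fun x => \sum_(i < n) F i x + F n x)).
- exact: mA.
- by move=> x _ /=; rewrite big_ord_recr.
apply: integrable_addR; last exact: H.
by apply: IH => i iN; apply: H; rewrite ltnS ltnW.
Qed.

Lemma Rintegral_sum n (F : nat -> T -> R) : (forall i, (i < n)%N -> itg (F i)) ->
  Rintegral P A (fun x => \sum_(i < n) F i x) = \sum_(i < n) Rintegral P A (F i).
Proof.
elim: n => [|n IH] H.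
  rewrite big_ord0 -[RHS](mul0r (fine (P A))) -(Rintegral_cst P mA).
  by apply: eq_Rintegral => x _; rewrite big_ord0.
have H' i : (i < n)%N -> itg (F i) by move=> iN; apply: H; rewrite ltnS ltnW.
rewrite big_ord_recr/= -IH// -RintegralD//; [|exact: integrable_sumR|exact: H].
by apply: eq_Rintegral => x _; rewrite big_ord_recr.
Qed.

Lemma Rintegral_indic_mul B f : Rintegral P A (fun x => \1_B x * f x) = Rintegral P (A `&` B) f.
Proof.
rewrite Rintegral_mkcondr; apply: eq_Rintegral => x _; rewrite indicE patchE.
by case: (x \in B); rewrite ?mul1r ?mul0r.
Qed.

Lemma Rintegral_indicR B : measurable B -> Rintegral P A \1_B = fine (P (A `&` B)).
Proof. by move=> mB; rewrite /Rintegral integral_indic// setIC. Qed.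

End RealIntegrable.

(** * The filtration and measurable events *)

Section Filtration.
Variable R : realType.
Implicit Types (s t : R) (A B : set (Omega R)).

Lemma Filt_Xt s t k : 0 <= s -> s <= t -> Filt t [set w : path_t R | Xt s w = k].
Proof. by move=> s0 st; apply: sub_sigma_algebra; exists s, k; rewrite s0 st. Qed.

Lemma Filt_setI t A B : Filt t A -> Filt t B -> Filt t (A `&` B).
Proof. exact: (@measurableI _ (g_sigma_algebraType (cyl t))). Qed.

Lemma Filt_le s t : s <= t -> Filt s `<=` (Filt t : set (set (path_t R))).
Proof.
move=> st; apply: sub_smallest2r; first exact: smallest_sigma_algebra.
by move=> _ [u [k [/andP[u0 us] ->]]]; exists u, k; rewrite u0 (le_trans us st).
Qed.

Lemma Filt_measurable t A : t <= 1 -> Filt t A -> measurable A.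
Proof. by move=> t1; exact: (Filt_le t1). Qed.

Lemma measurable_Xt_eq t k : 0 <= t <= 1 -> measurable [set w : Omega R | Xt t w = k].
Proof. by move=> /andP[t0 t1]; apply: (Filt_measurable (lexx 1)); exact: Filt_Xt. Qed.

Lemma measurable_Xt_set t (S : set nat) : 0 <= t <= 1 ->
  measurable [set w : Omega R | S (Xt t w)].
Proof.
move=> t01; rewrite (_ : mkset _ = \bigcup_(k in S) [set w : Omega R | Xt t w = k]).
  by apply: bigcup_measurable => k _; exact: measurable_Xt_eq.
by apply/seteqP; split => [w Sw|w [k Sk /= ->]//]; exists (Xt t w).
Qed.

Lemma Xt_eq_indic t k (w : Omega R) :
  (Xt t w == k)%:R = \1_[set w : Omega R | Xt t w = k] w :> R.
Proof.
rewrite indicE; congr (_%:R); congr nat_of_bool.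
by apply/eqP/idP => [h|]; rewrite inE.
Qed.

Lemma Xt_gt_indic t k (w : Omega R) :
  (k < Xt t w)%N%:R = \1_[set w : Omega R | (k < Xt t w)%N] w :> R.
Proof.
rewrite indicE; congr (_%:R); congr nat_of_bool.
by apply/idP/idP => [h|]; rewrite inE.
Qed.

(** The strict event is the countable union of the events [tau w <= 1 - 1 / (n + 1)], whose times
    stay in [[0, 1]]. *)
Lemma measurable_stop_lt1 (tau : Omega R -> R) : stopping_time tau ->
  measurable [set w | tau w < 1].
Proof.
move=> [tau0 mtau].
rewrite (_ : mkset _ = \bigcup_(n : nat) [set w | tau w <= 1 - n.+1%:R^-1]); last first.
  apply/seteqP; split => [w /= t1|w [n _ /=]].
    have [n] := ltr_add_invr t1; exists n => //=.
    by rewrite lerBrDr ltW.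
  by move=> /le_lt_trans; apply; rewrite gtrDl oppr_lt0 invr_gt0.
apply: bigcup_measurable => n _; apply: (@Filt_measurable (1 - n.+1%:R^-1)).
  by rewrite gerDl oppr_le0.
apply: mtau; rewrite gerDl oppr_le0 invr_ge0 ler0n andbT subr_ge0 invf_le1 ?ltr0n//.
by rewrite ler1n.
Qed.

End Filtration.

(** * The forward equation *)

Section ForwardDefect.
Variables (R : realType) (P : probability (Omega R) R) (l : R -> nat -> R) (C D : R).
Hypothesis lc : forall z, {within `[0, 1], continuous (l ^~ z)}.
Hypothesis l_gt0 : forall t z, 0 <= t <= 1 -> 0 < l t z.
Hypothesis C_ge0 : 0 <= C.
Hypothesis D_ge0 : 0 <= D.
Hypothesis l_le : forall t z, 0 <= t <= 1 -> l t z <= D + C * z%:R.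
Variables (k : nat) (a b : R).
Hypotheses (a_ge0 : 0 <= a) (ab : a <= b) (b_le1 : b <= 1).
Variable A : set (Omega R).
Hypothesis FA : Filt a A.
Hypothesis A0 : A `<=` [set w | Xt 0 w = 0%N].

Local Notation itg f := (P.-integrable A (EFin \o f)).

Let a1 : a <= 1. Proof. exact: le_trans ab b_le1. Qed.
Let mA : measurable A. Proof. exact: (Filt_measurable a1 FA). Qed.
Let g n i := grid a b n i.

Let g01 n i : (i <= n.+1)%N -> 0 <= g n i <= 1.
Proof.
move=> iN; rewrite (le_trans a_ge0 (grid_ge _ _ ab))/=.
exact: le_trans (grid_le ab iN) b_le1.
Qed.

(** The error of the Riemann-Stieltjes sum for [dQ_k = q_k dL_k], where [Q_k] is the mass of [A]
    above level [k]. Tails are used because a tail gains mass only by jumps out of the single level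
    [k]. *)
Definition forward_residual n : R :=
  fine (P (A `&` [set w | (k < Xt b w)%N])) - fine (P (A `&` [set w | (k < Xt a w)%N])) -
  \sum_(i < n.+1) fine (P (A `&` [set w | Xt (grid a b n i) w = k])) *
    (prim (l ^~ k) (grid a b n i.+1) - prim (l ^~ k) (grid a b n i)).

Let defect_term n i (w : Omega R) : R :=
  (prim (l ^~ k) (g n i.+1) - prim (l ^~ k) (g n i)) *
  \1_[set w : Omega R | Xt (g n i) w = k] w.
Let defect_sum n w := \sum_(i < n.+1) defect_term n i w.

Let defect_sumE n : forward_defect l k a b n =
  fun w => \1_[set w : Omega R | (k < Xt b w)%N] w - \1_[set w : Omega R | (k < Xt a w)%N] w
    - defect_sum n w.
Proof.
apply/funext => w; rewrite /forward_defect !Xt_gt_indic; congr (_ - _).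
by apply: eq_bigr => i _; rewrite Xt_eq_indic mulrC /defect_term.
Qed.

Let indic_itg (B : set (Omega R)) : measurable B -> itg \1_B.
Proof.
move=> mB; have := integrable_indicR mA mB (integrable_cstR P mA 1).
by apply: eq_integrable => // x _ /=; rewrite mulr1.
Qed.

Let b01 : 0 <= b <= 1. Proof. by rewrite (le_trans a_ge0 ab). Qed.
Let a01 : 0 <= a <= 1. Proof. by rewrite a_ge0. Qed.

Let defect_sum_itg n i : (i < n.+1)%N ->
  itg (defect_term n i).
Proof.
move=> iN; apply: integrable_scaleR => //; apply: indic_itg.
by apply: measurable_Xt_eq; apply: g01; exact: ltnW.
Qed.

Let m_gt t : 0 <= t <= 1 -> measurable [set w : Omega R | (k < Xt t w)%N].
Proof. by move=> t01; exact: (measurable_Xt_set (fun j => k < j)%N t01). Qed.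

Lemma forward_defect_integrable n : itg (forward_defect l k a b n).
Proof.
rewrite defect_sumE; apply: integrable_subR => //.
  by apply: integrable_subR => //; apply: indic_itg; exact: m_gt.
by apply: (integrable_sumR mA (F := defect_term n)) => i iN; exact: defect_sum_itg.
Qed.

Lemma Rintegral_forward_defect n :
  Rintegral P A (forward_defect l k a b n) = forward_residual n.
Proof.
have di : itg (defect_sum n) by apply: (integrable_sumR mA (F := defect_term n)) => i iN; exact: defect_sum_itg.
have gb := indic_itg (m_gt b01); have ga := indic_itg (m_gt a01).
rewrite defect_sumE RintegralB//; last exact: integrable_subR.
rewrite RintegralB// !Rintegral_indicR//; [|exact: m_gt|exact: m_gt].
rewrite /forward_residual; congr (_ - _).
rewrite (Rintegral_sum mA (F := defect_term n)) => [|i iN]; last exact: defect_sum_itg.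
apply: eq_bigr => i _; rewrite /defect_term RintegralZl//; last first.
  by apply: indic_itg; apply: measurable_Xt_eq; apply: g01; exact: ltnW.
rewrite Rintegral_indicR//; first by rewrite mulrC.
by apply: measurable_Xt_eq; apply: g01; exact: ltnW.
Qed.

Section Stopped.
Variable tau : Omega R -> R.
Hypothesis st : stopping_time tau.
Hypothesis mt : martingale P (fun t w => compensated l (Order.min t (tau w)) w).

Let M t w := compensated l (Order.min t (tau w)) w.

Let tau_ge0 w : 0 <= tau w. Proof. by case: st. Qed.

Let M_itg t (B : set (Omega R)) : 0 <= t <= 1 -> measurable B -> P.-integrable B (EFin \o M t).
Proof. by move=> t01 mB; case: mt => /(_ t t01) h _; apply: integrableS h. Qed.

Let mart_term n i w := \1_[set w : Omega R | Xt (g n i) w = k] w * (M (g n i.+1) w - M (g n i) w).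

Let mart_sumE n : (fun w => mart_sum l k a b n (tau w) w) = fun w =>
  \sum_(i < n.+1) mart_term n i w.
Proof. by apply/funext => w; apply: eq_bigr => i _; rewrite Xt_eq_indic /mart_term. Qed.

Let mart_term_itg n i : (i < n.+1)%N ->
  itg (mart_term n i).
Proof.
move=> iN; have gi := g01 (ltnW iN); have gi1 := g01 iN.
apply: integrable_indicR => //; first exact: measurable_Xt_eq.
by apply: integrable_subR => //; exact: M_itg.
Qed.

Lemma mart_sum_integrable n : itg (fun w => mart_sum l k a b n (tau w) w).
Proof. by rewrite mart_sumE; apply: (integrable_sumR mA (F := mart_term n)) => i; exact: mart_term_itg. Qed.

(** Each term is an increment of the stopped martingale over [A] intersected with [{X = k}] at the
    left end of the step, an event of the filtration at that time. *)
Lemma Rintegral_mart_sum n : Rintegral P A (fun w => mart_sum l k a b n (tau w) w) = 0.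
Proof.
rewrite mart_sumE (Rintegral_sum mA (F := mart_term n)) => [|i]; last exact: mart_term_itg.
rewrite big1// => i _.
have gi := g01 (ltnW (ltn_ord i)); have gi1 := g01 (ltn_ord i).
have mB : measurable (A `&` [set w : Omega R | Xt (g n i) w = k]).
  by apply: measurableI => //; exact: measurable_Xt_eq.
rewrite /mart_term Rintegral_indic_mul RintegralB//; [|exact: M_itg|exact: M_itg].
case/andP: gi => gi0 gi1'; case/andP: gi1 => _ gi11.
have FB : Filt (g n i) (A `&` [set w : Omega R | Xt (g n i) w = k]).
  by apply: Filt_setI; [exact: (Filt_le (grid_ge _ _ ab)) FA|exact: Filt_Xt].
have E := mt.2 _ _ gi0 (grid_leS _ _ ab) gi11 _ FB.
by rewrite /Rintegral /M E subrr.
Qed.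

Let K := D + C * k.+1%:R.
Let K_ge0 : 0 <= K. Proof. by rewrite addr_ge0// mulr_ge0. Qed.
Let m := Num.bound (2 * C).
Let Cm : 2 * C <= m.+1%:R.
Proof.
have /ltW/le_trans : 2 * C < m%:R by apply: archi_boundP; rewrite mulr_ge0.
by apply; rewrite ler_nat.
Qed.

(** Its grid is fixed by [m] and unrelated to [n], so it dominates for all [n] at once. *)
Let G w := gronwall_bound D (fun t => M t w) m m.+1.

Let G_itg : itg G.
Proof.
rewrite /G; have : (m.+1 <= m.+1)%N by [].
elim: {-2}m.+1 => [_|j IH jm] /=; first exact: integrable_cstR.
have {}IH := IH (ltnW jm).
have gg i : (i <= m.+1)%N -> 0 <= (grid 0 1 m i : R) <= 1.
  by move=> im; rewrite grid_ge//= grid_le.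
apply: integrable_scaleR => //; apply: integrable_addR => //; last exact: integrable_cstR.
apply: integrable_addR => //; last by apply: integrable_normR; apply: M_itg => //; exact/gg/ltnW.
by apply: integrable_addR => //; apply: integrable_normR; apply: M_itg => //; exact/gg.
Qed.

Let err n w := `|forward_defect l k a b n w - mart_sum l k a b n (tau w) w|.

Let err_itg n : itg (err n).
Proof.
by apply: integrable_normR; apply: integrable_subR => //;
  [exact: forward_defect_integrable|exact: mart_sum_integrable].
Qed.

Let err_le_dom n w : A w -> err n w <= (1 + K) + (G w + (D + C * G w)).
Proof.
move=> Aw; apply: (le_trans (ler_normB _ _)); apply: lerD.
  exact: forward_defect_le.
apply: (le_trans (mart_sum_le lc l_gt0 C_ge0 D_ge0 l_le k a_ge0 ab b_le1 n w (tau_ge0 w))).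
have h : (Xt (Order.min b (tau w)) w)%:R <= G w.
  apply: le_trans (stopped_le_gronwall lc l_gt0 C_ge0 D_ge0 l_le Cm (tau_ge0 w) (A0 Aw)).
  rewrite ler_nat Xt_le// le_min !ge_min b_le1/= lexx orbT//.
by apply: lerD => //; rewrite lerD2l ler_wpM2l.
Qed.

Let B := [set w | tau w < 1].
Let mB : measurable B. Proof. exact: measurable_stop_lt1. Qed.

(* Where [tau < 1] the error is only bounded, by a constant independent of [tau]; the
   probability of that event is made small afterwards. *)
Let trunc n w := Num.max (err n w - 2 * (1 + K) * \1_B w) 0.

(** Once the mesh is below the jump gap of the path, the truncated error is 0 if [tau w < 1] and at
    most [K] times the mesh otherwise. *)
Let trunc_cvg w : A w -> trunc n w @[n --> \oo] --> (0 : R).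
Proof.
move=> Aw; have [e e0 He] := Xt_gap w.
apply/cvgrPdist_le => x x0.
have [N1 _ HN1] := (@cvgr0Pnorm_lt _ _ _ _ _ (fun n : nat => n.+1%:R^-1 : R)).1 (@cvg_harmonic R) e e0.
(* [1 + K] in place of [K], which may vanish. *)
have xK : 0 < x / (1 + K) by rewrite divr_gt0// ltr_pwDl.
have [N2 _ HN2] := (@cvgr0Pnorm_lt _ _ _ _ _ (fun n : nat => n.+1%:R^-1 : R)).1 (@cvg_harmonic R) _ xK.
exists (maxn N1 N2) => // n /=; rewrite geq_max => /andP[n1 n2].
have {HN1 n1} := HN1 n n1; have {HN2 n2} := HN2 n n2.
move=> /(le_lt_trans (ler_norm _)) hx /(le_lt_trans (ler_norm _)) he.
have ba1 : b - a <= 1 by rewrite lerBlDr (le_trans b_le1)// lerDl.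
have ba : (b - a) / n.+1%:R <= n.+1%:R^-1 by rewrite ler_piMl.
have gap s t : t - s <= (b - a) / n.+1%:R -> (Xt t w <= (Xt s w).+1)%N.
  by move=> ts; apply: He; apply: le_lt_trans ts (le_lt_trans ba he).
rewrite sub0r normrN ger0_norm; last by rewrite le_max lexx orbT.
rewrite ge_max (ltW x0) andbT /trunc indicE.
case: (ltP (tau w) 1) => tw.
  rewrite mem_set//= mulr1.
  by apply: le_trans (ltW x0); rewrite subr_le0; exact: forward_defect_mart_sum_le.
rewrite memNset//=; last by move=> h; move: tw; rewrite leNgt h.
rewrite mulr0 subr0 /err.
apply: (le_trans (forward_defect_mart_sum lc l_gt0 C_ge0 D_ge0 l_le k a_ge0 ab b_le1 gap tw)).
rewrite -/K; apply: (@le_trans _ _ ((1 + K) * n.+1%:R^-1)).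
  by rewrite ler_pM// ?divr_ge0 ?subr_ge0// lerDr.
by rewrite mulrC -ler_pdivlMr ?ltr_pwDl// ltW.
Qed.

(** Since the martingale sum has mean zero, the residual is the mean of defect minus martingale sum.
    Dominated convergence handles the truncated part, and the part removed by truncation costs its
    constant times [P B]. *)
Lemma forward_residual_limsup (e : R) : 0 < e -> \forall n \near \oo,
  `|forward_residual n| <= e + 2 * (1 + K) * fine (P B).
Proof.
move=> e0.
have ti n : itg (fun w => err n w - 2 * (1 + K) * \1_B w).
  by apply: integrable_subR => //; apply: integrable_scaleR => //; exact: indic_itg.
have mtr n : measurable_fun A (EFin \o trunc n).
  apply/measurable_EFinP; apply: measurable_maxr => //.
  by apply/measurable_EFinP; apply: (measurable_int P); exact: ti.
have dom : itg (fun w => (1 + K) + (G w + (D + C * G w))).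
  apply: integrable_addR => //; first exact: integrable_cstR.
  apply: integrable_addR => //; apply: integrable_addR => //; first exact: integrable_cstR.
  exact: integrable_scaleR.
have le_dom n w : A w -> 0 <= trunc n w <= (1 + K) + (G w + (D + C * G w)).
  move=> Aw; have h := err_le_dom n Aw; have h0 : 0 <= err n w by exact: normr_ge0.
  rewrite le_max lexx orbT/= ge_max (le_trans h0 h) andbT (le_trans _ h)// gerBl.
  by rewrite !mulr_ge0// addr_ge0.
have cv : {ae P, forall w, A w -> (EFin \o trunc n) w @[n --> \oo] --> (cst 0%E w : \bar R)}.
  apply: aeW => w Aw; apply/fine_cvgP; split; first exact: nearW.
  exact: trunc_cvg.
have ledom : {ae P, forall w n, A w ->
    (`|(EFin \o trunc n) w| <= ((1 + K) + (G w + (D + C * G w)))%:E)%E}.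
  apply: aeW => w n Aw; have /andP[h0 h1] := le_dom n w Aw.
  by rewrite /= lee_fin ger0_norm.
have [_ _] := dominated_convergence mA mtr (measurable_cst _) cv dom ledom.
rewrite integral0_eq// => /fine_cvg/cvgrPdist_lt/(_ e e0); apply: filterS => n /=.
rewrite sub0r normrN => hn.
have -> : forward_residual n =
    Rintegral P A (fun w => forward_defect l k a b n w - mart_sum l k a b n (tau w) w).
  rewrite RintegralB ?Rintegral_mart_sum ?subr0 ?Rintegral_forward_defect//.
    exact: forward_defect_integrable.
  exact: mart_sum_integrable.
have di : itg (fun w => forward_defect l k a b n w - mart_sum l k a b n (tau w) w).
  by apply: integrable_subR => //;
    [exact: forward_defect_integrable|exact: mart_sum_integrable].
apply: (le_trans (le_normr_Rintegral mA di)).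
have tri : itg (trunc n).
  apply: (le_integrable mA (mtr n)) dom => w Aw /=.
  by have /andP[h0 h1] := le_dom n w Aw; rewrite lee_fin !ger0_norm// (le_trans h0 h1).
apply: (@le_trans _ _ (Rintegral P A (fun w => trunc n w + 2 * (1 + K) * \1_B w))).
  apply: le_Rintegral => //.
  - exact: err_itg.
  - by apply: integrable_addR => //; apply: integrable_scaleR => //; exact: indic_itg.
  - by move=> w _; rewrite -lerBlDr le_max lexx.
rewrite RintegralD//; last by apply: integrable_scaleR => //; exact: indic_itg.
rewrite RintegralZl//; last exact: indic_itg.
apply: lerD; first by apply: ltW; apply: le_lt_trans hn; exact: ler_norm.
rewrite Rintegral_indicR//; apply: ler_wpM2l.
  exact: mulr_ge0 (ler0n _ 2) (addr_ge0 ler01 K_ge0).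
by apply: fine_probability_le => //; exact: measurableI.
Qed.

End Stopped.

(** The residual does not mention the stopping times. One of them is fixed first, with [P {tau < 1}]
    small; only then is the grid refined. *)
Lemma forward_residual_cvg : markov_counting P l -> forward_residual n @[n --> \oo] --> (0 : R).
Proof.
move=> [tau [st [tau_le [tau_ae mt]]]].
apply/cvgrPdist_le => e e0.
pose B n := [set w | tau n w < 1].
have mB n : measurable (B n) by exact: measurable_stop_lt1.
have mI : measurable (\bigcap_n B n) by apply: bigcap_measurable => //.
(* A path in every [B n] never has [1 <= tau n], which is almost surely excluded. *)
have I0 : P (\bigcap_n B n) = 0%E.
  case: tau_ae => N [mN N0 NB]; apply/eqP; rewrite -measure_le0 -N0.
  apply: le_measure; rewrite ?inE// => w Bw; apply: NB => /= -[n].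
  by rewrite leNgt => /negP; apply; exact: Bw.
have B_dec : {homo B : n m / (n <= m)%N >-> (m <= n)%O}.
  move=> n1 n2 n12; rewrite subsetEset => w; apply: le_lt_trans.
  exact: (@homo_leq _ (fun n => tau n w) <=%O (@lexx _ _) (@le_trans _ _) (tau_le ^~ w)).
have B0 : (P (B 0%N) < +oo)%E by rewrite ltey_eq fin_num_measure.
have /fine_cvg cvB : P (B n) @[n --> \oo] --> 0%:E.
  have I0' : 0%:E = P (\bigcap_n B n) by rewrite I0.
  by rewrite I0'; exact: (nonincreasing_cvg_mu B0 mB mI B_dec).
pose K := D + C * k.+1%:R.
have K_ge0 : 0 <= K by rewrite addr_ge0// mulr_ge0.
have e1 : 0 < e / 2 / (2 * (1 + K)) by rewrite !divr_gt0 ?mulr_gt0// ltr_pwDl.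
have /cvgrPdist_lt/(_ _ e1)[N _ /(_ N (leqnn N))/=] := cvB.
rewrite sub0r normrN ger0_norm ?fine_ge0// => hN.
have e2 : 0 < e / 2 by rewrite divr_gt0.
apply: filterS (forward_residual_limsup (st N) (mt N) e2) => n.
rewrite sub0r normrN => /le_trans; apply.
have : 2 * (1 + K) * fine (P (B N)) <= e / 2.
  by rewrite mulrC -ler_pdivlMr ?mulr_gt0 ?ltr_pwDl// ltW.
by rewrite /K /B; lra.
Qed.

End ForwardDefect.

(** * Derivatives, continuity on an interval, monotonicity *)

Section Calculus.
Variable R : realType.
Implicit Types (f g : R -> R) (t x a b : R).

Lemma is_derive_pmul f g t a b : is_derive t 1 f a -> is_derive t 1 g b ->
  is_derive t 1 (fun x => f x * g x) (a * g t + f t * b).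
Proof.
move=> fa gb; have h := is_deriveM fa gb; apply: (is_derive_eq h).
by rewrite addrC [a * _]mulrC.
Qed.

Lemma is_derive_padd f g t a b : is_derive t 1 f a -> is_derive t 1 g b ->
  is_derive t 1 (fun x => f x + g x) (a + b).
Proof. by move=> fa gb; exact: (is_deriveD fa gb). Qed.

Lemma is_derive_psub f g t a b : is_derive t 1 f a -> is_derive t 1 g b ->
  is_derive t 1 (fun x => f x - g x) (a - b).
Proof. by move=> fa gb; exact: (is_deriveB fa gb). Qed.

Lemma is_derive_pscale (c : R) f t a : is_derive t 1 f a ->
  is_derive t 1 (fun x => c * f x) (c * a).
Proof. by move=> fa; exact: (is_deriveZ c fa). Qed.

Lemma is_derive_pcst (c t : R) : is_derive t 1 (fun=> c) 0.
Proof. exact: is_derive_cst. Qed.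

Lemma is_derive_pexp f t a : is_derive t 1 f a ->
  is_derive t 1 (fun x => expR (f x)) (expR (f t) * a).
Proof. by move=> fa; exact: is_derive1_comp. Qed.

Lemma is_derive_pexpn f t a n : is_derive t 1 f a ->
  is_derive t 1 (fun x => f x ^+ n.+1) (n.+1%:R * f t ^+ n * a).
Proof.
move=> fa; have := is_deriveX n.+1 fa => h.
by rewrite (_ : (fun x => f x ^+ n.+1) = (f ^+ n.+1)%R)//; apply/funext => x; rewrite fctE.
Qed.

Lemma is_derive_cvg f t a : h^-1 * (f (t + h) - f t) @[h --> 0^'] --> a ->
  is_derive t 1 f a.
Proof.
move=> H; have H' : h^-1 *: ((f \o shift t) (h *: 1) - f t) @[h --> (0 : R)^'] --> a.
  apply: cvg_trans H; apply: near_eq_cvg; near=> h => /=.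
  by rewrite /GRing.scale/= mulr1 [t + h]addrC.
by split; [apply/cvg_ex; exists a|exact: cvg_lim H'].
Unshelve. all: by end_near. Qed.

Lemma is_derive0_quadratic f t (M d : R) : 0 < d -> 0 <= M ->
  (forall h, `|h| < d -> `|f (t + h) - f t| <= M * `|h| * `|h|) -> is_derive t 1 f 0.
Proof.
move=> d0 M0 H; apply: is_derive_cvg; apply/cvgrPdist_le => e e0.
have M1 : 0 < M + 1 by rewrite ltr_wpDl.
near=> h.
have h0 : h != 0 by near: h; exact: nbhs_dnbhs_neq.
have hd : `|h| < d.
  by near: h; apply: dnbhs0_lt.
have he : `|h| < e / (M + 1).
  by near: h; apply: dnbhs0_lt; rewrite divr_gt0.
rewrite sub0r normrN normrM normfV ler_pdivrMl ?normr_gt0//.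
apply: (le_trans (H h hd)); rewrite mulrC ler_wpM2l//.
apply: (@le_trans _ _ ((M + 1) * `|h|)); first by rewrite ler_wpM2r// lerDl.
by rewrite mulrC -ler_pdivlMr// ltW.
Unshelve. all: by end_near. Qed.

Lemma near_is_derive f g t d a b : a < t < b ->
  (forall x, a < x < b -> f x = g x) -> is_derive t 1 f d -> is_derive t 1 g d.
Proof.
move=> /andP[ta tb] fg; apply: near_eq_is_derive; near=> x; apply: fg.
apply/andP; split; near: x; [exact: lt_nbhsr|exact: lt_nbhsl].
Unshelve. all: by end_near. Qed.

Lemma within_continuous_eps f a b :
  (forall t, a <= t <= b -> forall e : R, 0 < e -> exists2 d : R, 0 < d &
    forall u, a <= u <= b -> `|u - t| < d -> `|f t - f u| < e) ->
  {within `[a, b], continuous f}.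
Proof.
move=> H; apply/subspace_continuousP => t /=; rewrite in_itv/= => tab.
apply/cvgrPdist_lt => e e0; have [d d0 Hd] := H t tab e e0.
rewrite near_withinE; near=> u; rewrite /= in_itv/= => uab; apply: (Hd _ uab).
rewrite distrC; near: u; exact: nbhsx_ballx.
Unshelve. all: by end_near. Qed.

Lemma within_continuous_lipschitz f a b (c : R) :
  (forall t u, a <= t -> t <= u -> u <= b -> `|f u - f t| <= c * (u - t)) ->
  {within `[a, b], continuous f}.
Proof.
move=> H; apply: within_continuous_eps => t /andP[t1 t2] e e0.
have c1 : 0 < `|c| + 1 by rewrite ltr_wpDl.
exists (e / (`|c| + 1)); first by rewrite divr_gt0.
move=> u /andP[u1 u2]; rewrite ltr_pdivlMr// => ut.
apply: le_lt_trans ut; rewrite mulrC.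
have cc : c <= `|c| + 1 by rewrite (le_trans (ler_norm c))// lerDl.
case: (leP t u) => tu.
  rewrite distrC; apply: (le_trans (H _ _ t1 tu u2)); rewrite [`|u - t|]ger0_norm ?subr_ge0//.
  by rewrite ler_wpM2r ?subr_ge0.
apply: (le_trans (H _ _ u1 (ltW tu) t2)); rewrite distrC [`|t - u|]ger0_norm ?subr_ge0 ?(ltW tu)//.
by rewrite ler_wpM2r ?subr_ge0// ltW.
Qed.

Lemma within_continuous_pmul f g (A : set R) : {within A, continuous f} ->
  {within A, continuous g} -> {within A, continuous (fun x => f x * g x)}.
Proof.
move=> /subspace_continuousP cf /subspace_continuousP cg.
by apply/subspace_continuousP => x Ax; apply: cvgM; [exact: cf|exact: cg].
Qed.

Lemma within_continuous_psub f g (A : set R) : {within A, continuous f} ->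
  {within A, continuous g} -> {within A, continuous (fun x => f x - g x)}.
Proof.
move=> /subspace_continuousP cf /subspace_continuousP cg.
by apply/subspace_continuousP => x Ax; apply: cvgB; [exact: cf|exact: cg].
Qed.

Lemma within_continuous_pcomp f g (A : set R) : continuous g ->
  {within A, continuous f} -> {within A, continuous (fun x => g (f x))}.
Proof.
move=> cg /subspace_continuousP cf.
apply/subspace_continuousP => x Ax; apply: (@cvg_comp _ _ _ f g); first exact: cf.
exact: cg.
Qed.

(** Differential inequalities are integrated with this lemma, applied to the difference of the two
    sides. *)
Lemma ler_of_derive f (f' : R -> R) a b : a <= b -> {within `[a, b], continuous f} ->
  (forall t, a < t < b -> is_derive t 1 f (f' t)) ->
  (forall t, a < t < b -> 0 <= f' t) -> f a <= f b.
Proof.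
move=> ab cf df f'0.
apply: (ger0_derive1_le_cc _ _ cf) => //.
- by move=> t; rewrite in_itv/= => /df[].
- move=> t; rewrite in_itv/= => tab; rewrite derive1E.
  by have [_ ->] := df t tab; exact: f'0.
- by rewrite in_itv/= lexx ab.
- by rewrite in_itv/= lexx ab.
Qed.

End Calculus.

(** * Comparison for a triangular chain of linear equations *)

Section Chain.
Variables (R : realType) (rho rho' : R -> R) (s : R).
Hypothesis rho_continuous : {within `[s, 1], continuous rho}.
Hypothesis rho_derive : forall t, s < t < 1 -> is_derive t 1 rho (rho' t).
Hypothesis rho'_ge0 : forall t, s < t < 1 -> 0 <= rho' t.

(** The volume, in the clock [rho], of the ordered [j]-tuples of times between [s] and [t];
    equivalently the [j]-fold iterated integral of [rho']. *)
Definition simplex (j : nat) (t : R) : R := (rho t - rho s) ^+ j / j`!%:R.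

Lemma simplex_s j : simplex j.+1 s = 0.
Proof. by rewrite /simplex subrr expr0n mul0r. Qed.

Lemma simplex_continuous j : {within `[s, 1], continuous (simplex j)}.
Proof.
apply: within_continuous_pmul; last first.
  by apply/subspace_continuousP => x _; exact: cvg_cst.
apply: (@within_continuous_pcomp _ _ (fun x => (x - rho s) ^+ j)) rho_continuous => x.
apply: (@continuous_comp _ _ _ (fun x => x - rho s) (fun y => y ^+ j)).
  by apply: cvgB; [exact: cvg_id|exact: cvg_cst].
exact: exprn_continuous.
Qed.

Lemma simplex_derive j t : s < t < 1 ->
  is_derive t 1 (simplex j.+1) (rho' t * simplex j t).
Proof.
move=> ts; have h := is_derive_psub (rho_derive ts) (is_derive_pcst (rho s) t).
have h' := is_derive_pmul (is_derive_pexpn j h) (is_derive_pcst (j.+1`!%:R^-1) t).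
apply: (is_derive_eq h'); rewrite mulr0 addr0 subr0 /simplex factS natrM.
have : j.+1%:R != 0 :> R by rewrite pnatr_eq0.
have : j`!%:R != 0 :> R by rewrite pnatr_eq0 -lt0n fact_gt0.
move: (j.+1%:R) (j`!%:R) ((rho t - rho s) ^+ j) => x y z y0 x0.
by field; rewrite x0 y0.
Qed.

Lemma rho_s_le t : s <= t <= 1 -> rho s <= rho t.
Proof.
move=> /andP[st t1]; apply: (@ler_of_derive _ _ rho') => //.
- by apply: continuous_subspaceW rho_continuous; apply: subset_itvl; rewrite bnd_simp.
- by move=> u /andP[su ut]; apply: rho_derive; rewrite su (lt_le_trans ut t1).
- by move=> u /andP[su ut]; apply: rho'_ge0; rewrite su (lt_le_trans ut t1).
Qed.

Lemma simplex_ge0 j t : s <= t <= 1 -> 0 <= simplex j t.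
Proof. by move=> st; rewrite divr_ge0// exprn_ge0// subr_ge0 rho_s_le. Qed.

Variables (v w : nat -> R -> R) (v0 : R) (c : nat -> R).
Hypothesis v_continuous : forall j, {within `[s, 1], continuous (v j)}.
Hypothesis v_derive : forall j t, s < t < 1 ->
  is_derive t 1 (v j.+1) (w j t * v j t).
Hypothesis v_init : forall j, v j.+1 s = 0.
Hypothesis v_zero : forall t, s <= t <= 1 -> v 0%N t = v0.
Hypothesis v0_ge0 : 0 <= v0.
Hypothesis c_ge0 : forall j, 0 <= c j.

Let bound j t := v0 * (\prod_(i < j) c i) * simplex j t.

Let bound0 t : bound 0%N t = v0.
Proof. by rewrite /bound /simplex big_ord0 expr0 fact0 divr1 !mulr1. Qed.

Let prod_ge0 j : 0 <= v0 * \prod_(i < j) c i.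
Proof. by rewrite mulr_ge0// prodr_ge0. Qed.

Let bound_cont j : {within `[s, 1], continuous (bound j)}.
Proof.
apply: within_continuous_pmul (@simplex_continuous j).
by apply/subspace_continuousP => x _; exact: cvg_cst.
Qed.

Let bound_derive j t : s < t < 1 -> is_derive t 1 (bound j.+1) (c j * rho' t * bound j t).
Proof.
move=> st; have h := is_derive_pscale (v0 * \prod_(i < j.+1) c i) (simplex_derive j st).
by apply: (is_derive_eq h); rewrite /bound big_ord_recr/=; ring.
Qed.

(** Induction on the level: at [j + 1] both sides vanish at [s], and the bound has the larger
    derivative by the hypothesis on [w] and the case [j]. *)
Lemma chain_upper : (forall j t, s <= t <= 1 -> 0 <= v j t) ->
  (forall j t, s < t < 1 -> w j t <= c j * rho' t) ->
  forall j t, s <= t <= 1 -> v j t <= v0 * (\prod_(i < j) c i) * simplex j t.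
Proof.
move=> v_ge0 w_le; elim=> [t st|j IH t /andP[st t1]]; first by rewrite v_zero// -/(bound 0%N t) bound0.
rewrite -subr_ge0 -(_ : bound j.+1 s - v j.+1 s = 0); last first.
  by rewrite /bound simplex_s v_init mulr0 subrr.
apply: (@ler_of_derive _ (fun t => bound j.+1 t - v j.+1 t)
  (fun t => c j * rho' t * bound j t - w j t * v j t)) => //.
- apply: (@continuous_subspaceW _ _ _ `[s, 1]); last first.
    exact: within_continuous_psub (@bound_cont _) (@v_continuous _).
  by apply: subset_itvl; rewrite bnd_simp.
- move=> u /andP[su ut]; have u1 : s < u < 1 by rewrite su (lt_le_trans ut t1).
  exact: is_derive_psub (bound_derive _ u1) (v_derive _ u1).
- move=> u /andP[su ut]; have u1 : s < u < 1 by rewrite su (lt_le_trans ut t1).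
  have u1' : s <= u <= 1 by case/andP: u1 => /ltW -> /ltW ->.
  rewrite subr_ge0; apply: (@le_trans _ _ (c j * rho' u * v j u)).
    by rewrite ler_wpM2r ?v_ge0 ?w_le.
  by rewrite ler_wpM2l ?mulr_ge0 ?c_ge0 ?rho'_ge0// IH.
Qed.

Lemma chain_lower : (forall j t, s < t < 1 -> c j * rho' t <= w j t) ->
  forall j t, s <= t <= 1 -> v0 * (\prod_(i < j) c i) * simplex j t <= v j t.
Proof.
move=> w_ge; elim=> [t st|j IH t /andP[st t1]]; first by rewrite v_zero// -/(bound 0%N t) bound0.
rewrite -subr_ge0 -(_ : v j.+1 s - bound j.+1 s = 0); last first.
  by rewrite /bound simplex_s v_init mulr0 subrr.
apply: (@ler_of_derive _ (fun t => v j.+1 t - bound j.+1 t)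
  (fun t => w j t * v j t - c j * rho' t * bound j t)) => //.
- apply: (@continuous_subspaceW _ _ _ `[s, 1]); last first.
    exact: within_continuous_psub (@v_continuous _) (@bound_cont _).
  by apply: subset_itvl; rewrite bnd_simp.
- move=> u /andP[su ut]; have u1 : s < u < 1 by rewrite su (lt_le_trans ut t1).
  exact: is_derive_psub (v_derive _ u1) (bound_derive _ u1).
- move=> u /andP[su ut]; have u1 : s < u < 1 by rewrite su (lt_le_trans ut t1).
  have u1' : s <= u <= 1 by case/andP: u1 => /ltW -> /ltW ->.
  have b0 : 0 <= bound j u by rewrite mulr_ge0// simplex_ge0.
  rewrite subr_ge0; apply: (@le_trans _ _ (w j u * bound j u)).
    by rewrite ler_wpM2r ?w_ge.
  rewrite ler_wpM2l ?IH// (le_trans _ (w_ge _ _ u1))// mulr_ge0 ?c_ge0 ?rho'_ge0//.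
Qed.

End Chain.

(** * From vanishing residuals to the differential system *)

Section ForwardEquation.
Variables (R : realType) (P : probability (Omega R) R) (l : R -> nat -> R) (C D : R).
Hypothesis lc : forall z, {within `[0, 1], continuous (l ^~ z)}.
Hypothesis l_gt0 : forall t z, 0 <= t <= 1 -> 0 < l t z.
Hypothesis C_ge0 : 0 <= C.
Hypothesis D_ge0 : 0 <= D.
Hypothesis l_le : forall t z, 0 <= t <= 1 -> l t z <= D + C * z%:R.
Hypothesis Pl : markov_counting P l.
Variable s : R.
Hypotheses (s_ge0 : 0 <= s) (s_le1 : s <= 1).
Variable A : set (Omega R).
Hypothesis FA : Filt s A.
Hypothesis A0 : A `<=` [set w | Xt 0 w = 0%N].

Definition marginal (k : nat) (t : R) : R := fine (P (A `&` [set w | Xt t w = k])).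
Local Notation q := marginal.
Let Q k t : R := fine (P (A `&` [set w | (k < Xt t w)%N])).
(** [Q' k.+1] is convertible to [Q k], and [Q' 0] is constant, so [q k = Q' k - Q k] covers level 0
    as well. *)
Let Q' k t : R := fine (P (A `&` [set w | (k <= Xt t w)%N])).
Local Notation L k := (prim (l ^~ k)).

Let mA : measurable A. Proof. exact: (Filt_measurable s_le1 FA). Qed.

Let s01 t : s <= t -> t <= 1 -> 0 <= t <= 1.
Proof. by move=> st ->; rewrite (le_trans s_ge0 st). Qed.

Lemma marginal_ge0 k t : 0 <= q k t.
Proof. by rewrite fine_ge0. Qed.

Lemma marginal_le1 k t : s <= t -> t <= 1 -> q k t <= 1.
Proof.
move=> st t1; have mB : measurable (A `&` [set w | Xt t w = k]).
  by apply: measurableI => //; apply: measurable_Xt_eq; exact: s01.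
have := probability_le1 P mB; rewrite /marginal.
by rewrite -[X in (X <= _)%E]fineK ?fin_num_measure// lee_fin.
Qed.

(** Bounds on [q k] pass to the Riemann-Stieltjes sums and then to the limit, with no regularity of
    [q k] assumed. It is used twice: the bounds 0 and 1 make the marginals Lipschitz, and this then
    supplies narrow bounds around [q k t], hence a derivative. *)
Lemma forward_bounds k a b (lo hi : R) : s <= a -> a <= b -> b <= 1 ->
  (forall r, a <= r -> r <= b -> lo <= q k r <= hi) ->
  lo * (L k b - L k a) <= Q k b - Q k a <= hi * (L k b - L k a).
Proof.
move=> sa ab b1 H; have a_ge0 : 0 <= a by exact: le_trans s_ge0 sa.
have cv := forward_residual_cvg lc l_gt0 C_ge0 D_ge0 l_le k a_ge0 ab b1
  (Filt_le sa FA) A0 Pl.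
have tel n : L k b - L k a =
    \sum_(i < n.+1) (L k (grid a b n i.+1) - L k (grid a b n i)).
  rewrite -(big_mkord xpredT (fun i => L k (grid a b n i.+1) - L k (grid a b n i))).
  by rewrite telescope_sumr// gridn grid0.
have Hn n (i : 'I_n.+1) : 0 <= L k (grid a b n i.+1) - L k (grid a b n i) /\
    lo <= q k (grid a b n i) <= hi.
  have i1 := ltn_ord i; split.
    have /andP[] := @rate_prim_bounds _ _ _ _ lc l_gt0 l_le k (grid a b n i) (grid a b n i.+1)
      (le_trans a_ge0 (grid_ge _ _ ab)) (grid_leS _ _ ab) (le_trans (grid_le ab i1) b1).
    by [].
  by apply: H; [exact: grid_ge|apply: grid_le => //; exact: ltnW].
apply/andP; split; apply/ler_addgt0Pr => e e0;
  have /cvgrPdist_le/(_ e e0)[n _ /(_ n (leqnn n))] := cv;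
  rewrite sub0r normrN ler_norml => /andP[r1 r2]; move: r1 r2;
  rewrite /forward_residual -/(Q k b) -/(Q k a).
- have : lo * (L k b - L k a) <= \sum_(i < n.+1) q k (grid a b n i) *
      (L k (grid a b n i.+1) - L k (grid a b n i)).
    rewrite (tel n) mulr_sumr; apply: ler_sum => i _; have [h1 /andP[h2 h3]] := Hn n i.
    exact: ler_wpM2r.
  rewrite /marginal; move: (\sum_(i < _) _) => S; lra.
- have : \sum_(i < n.+1) q k (grid a b n i) *
      (L k (grid a b n i.+1) - L k (grid a b n i)) <= hi * (L k b - L k a).
    rewrite (tel n) mulr_sumr; apply: ler_sum => i _; have [h1 /andP[h2 h3]] := Hn n i.
    exact: ler_wpM2r.
  rewrite /marginal; move: (\sum_(i < _) _) => S; lra.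
Qed.

Let K k := D + C * k%:R.
Let K_ge0 k : 0 <= K k. Proof. by rewrite addr_ge0// mulr_ge0. Qed.

Let L_lip k a b : s <= a -> a <= b -> b <= 1 -> 0 <= L k b - L k a <= K k * (b - a).
Proof. by move=> sa ab b1; apply: rate_prim_bounds => //; exact: le_trans s_ge0 sa. Qed.

Let Q_lip k a b : s <= a -> a <= b -> b <= 1 -> 0 <= Q k b - Q k a <= K k * (b - a).
Proof.
move=> sa ab b1; have /andP[h1 h2] := L_lip k sa ab b1.
have /andP[] : 0 * (L k b - L k a) <= Q k b - Q k a <= 1 * (L k b - L k a).
  apply: forward_bounds => // r ar rb.
  by rewrite marginal_ge0 marginal_le1 ?(le_trans sa ar) ?(le_trans rb b1).
by rewrite mul0r mul1r => -> /le_trans; apply.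
Qed.

Let Q'0 t : Q' 0%N t = fine (P A).
Proof. by rewrite /Q' (_ : mkset _ = setT) ?setIT//; apply/seteqP; split. Qed.

Let Q'S k t : Q' k.+1 t = Q k t. Proof. by []. Qed.

Let Q'_lip k a b : s <= a -> a <= b -> b <= 1 -> 0 <= Q' k b - Q' k a <= K k * (b - a).
Proof.
case: k => [|k] sa ab b1.
  by rewrite !Q'0 subrr lexx mulr_ge0// subr_ge0.
rewrite !Q'S; have /andP[-> /le_trans] := Q_lip k sa ab b1; apply.
by rewrite ler_wpM2r ?subr_ge0// lerD2l ler_wpM2l// ler_nat.
Qed.

Let qE k t : s <= t -> t <= 1 -> q k t = Q' k t - Q k t.
Proof.
move=> st t1; have t01 := s01 st t1.
have m1 : measurable (A `&` [set w | Xt t w = k]).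
  by apply: measurableI => //; exact: measurable_Xt_eq.
have m2 : measurable (A `&` [set w | (k < Xt t w)%N]).
  by apply: measurableI => //; exact: (measurable_Xt_set (fun j => k < j)%N t01).
have E : A `&` [set w | (k <= Xt t w)%N] =
    (A `&` [set w | Xt t w = k]) `|` (A `&` [set w | (k < Xt t w)%N]).
  rewrite -setIUr; congr (_ `&` _); apply/seteqP; split => w /=.
    by rewrite leq_eqVlt => /orP[/eqP ->|]; [left|right].
  by case=> [->//|/ltnW].
rewrite /Q' E measureU//; last first.
  by rewrite -subset0 => w [[_ /= ->] [_ /=]]; rewrite ltnn.
by rewrite fineD ?fin_num_measure// addrK.
Qed.

Lemma marginal_lip k a b : s <= a -> a <= b -> b <= 1 ->
  `|q k b - q k a| <= K k * (b - a).
Proof.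
move=> sa ab b1; rewrite !qE//; try lra.
have := Q_lip k sa ab b1; have := Q'_lip k sa ab b1.
move: (K k * _) (Q' k b) (Q' k a) (Q k b) (Q k a) => c x y z u.
by move=> /andP[? ?] /andP[? ?]; rewrite ler_norml; apply/andP; split; lra.
Qed.

(** Over [[a, b]] both the variation of [q k] and the increment of [L k] are at most
    [K k * (b - a)]; the error of freezing [q k] at [t] is their product. *)
Lemma forward_quadratic k a b t : s <= a -> a <= t -> t <= b -> b <= 1 ->
  `|(Q k b - q k t * L k b) - (Q k a - q k t * L k a)| <= K k * K k * (b - a) * (b - a).
Proof.
move=> sa at' tb b1; have ab := le_trans at' tb.
have /andP[h1 h2] := L_lip k sa ab b1.
have H r : a <= r -> r <= b -> q k t - K k * (b - a) <= q k r <= q k t + K k * (b - a).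
  move=> ar rb.
  have h : `|q k r - q k t| <= K k * (b - a).
    case: (leP r t) => rt.
      rewrite distrC; apply: (le_trans (marginal_lip k _ rt _)); try lra.
      by rewrite ler_wpM2l//; lra.
    apply: (le_trans (marginal_lip k _ (ltW rt) _)); try lra.
    by rewrite ler_wpM2l//; lra.
  by move: h; rewrite ler_norml => /andP[? ?]; apply/andP; split; lra.
have := forward_bounds sa ab b1 H.
have h3 : K k * (b - a) * (L k b - L k a) <= K k * K k * (b - a) * (b - a).
  rewrite -!mulrA [K k * ((b - a) * _)]mulrCA.
  rewrite [X in _ <= X](_ : _ = K k * ((b - a) * (K k * (b - a)))); last by ring.
  rewrite mulrCA ler_wpM2l// ler_wpM2l// subr_ge0//.
move: h3; move: (K k * K k * _ * _) (K k * (b - a)) (q k t) (Q k b) (Q k a) (L k b) (L k a).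
move=> c x y z u v w h3 /andP[g1 g2]; rewrite ler_norml; apply/andP; split; lra.
Qed.

(** [Q k] minus [q k t * L k], with the coefficient frozen, has derivative 0 at [t] by the quadratic
    estimate, taken with [t] as left end and then as right end. *)
Lemma tail_derive k t : s < t < 1 -> is_derive t 1 (Q k) (l t k * q k t).
Proof.
move=> /andP[st t1].
have t01 : 0 < t < 1 by rewrite (le_lt_trans s_ge0 st).
have d0 : is_derive t 1 (fun x => Q k x - q k t * L k x) 0.
  apply: (@is_derive0_quadratic _ _ _ (K k * K k) (Num.min (t - s) (1 - t))).
  - by rewrite lt_min !subr_gt0 st t1.
  - by rewrite mulr_ge0.
  move=> h; rewrite lt_min => /andP[h1 h2].
  case: (leP 0 h) => h0.
    move: h1 h2; rewrite ger0_norm// => h1 h2.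
    have := @forward_quadratic k t (t + h) t; rewrite (_ : t + h - t = h); last by ring.
    by apply; lra.
  move: h1 h2; rewrite ltr0_norm// => h1 h2.
  have := @forward_quadratic k (t + h) t t; rewrite (_ : t - (t + h) = - h); last by ring.
  by rewrite distrC; apply; lra.
have h := is_derive_padd d0 (is_derive_pscale (q k t) (rate_prim_derive lc k t01)).
rewrite (_ : Q k = fun x => Q k x - q k t * L k x + q k t * L k x).
  by apply: (is_derive_eq h); rewrite add0r mulrC.
by apply/funext => x; rewrite subrK.
Qed.

Definition marginal_rate k t : R :=
  (if k is k'.+1 then l t k' * q k' t else 0) - l t k * q k t.

Lemma marginal_derive k t : s < t < 1 -> is_derive t 1 (q k) (marginal_rate k t).
Proof.
move=> st; apply: (@near_is_derive _ (fun x => Q' k x - Q k x) _ _ _ s 1) => //.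
  by move=> x /andP[/ltW ? /ltW ?]; rewrite qE.
apply: is_derive_psub; last exact: tail_derive.
case: k => [|k]; last exact: tail_derive.
rewrite (_ : Q' 0%N = fun=> fine (P A)); first exact: is_derive_pcst.
by apply/funext => x; exact: Q'0.
Qed.

Definition weighted k t : R := q k t * expR (L k t).
(** The index is that of the level being left: this is [w_(k+1)] of the overview. *)
Definition weighted_rate k t : R := l t k * expR (L k.+1 t - L k t).

Lemma weighted_continuous k : {within `[s, 1], continuous (weighted k)}.
Proof.
apply: within_continuous_pmul.
  by apply: (@within_continuous_lipschitz _ _ _ _ (K k)) => t u; exact: marginal_lip.
apply: within_continuous_pcomp; first exact: continuous_expR.
apply: (@within_continuous_lipschitz _ _ _ _ (K k)) => t u st tu u1.
by have /andP[h1 h2] := L_lip k st tu u1; rewrite ger0_norm.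
Qed.

Let weighted_derive_gen k t : s < t < 1 -> is_derive t 1 (weighted k)
  ((if k is k'.+1 then l t k' * q k' t else 0) * expR (L k t)).
Proof.
move=> st; have t01 : 0 < t < 1 by case/andP: st => /(le_lt_trans s_ge0) -> ->.
have h := is_derive_pmul (marginal_derive k st) (is_derive_pexp (rate_prim_derive lc k t01)).
by apply: (is_derive_eq h); rewrite /marginal_rate; move: (if k is _.+1 then _ else _) => x; ring.
Qed.

Lemma weighted_derive k t : s < t < 1 ->
  is_derive t 1 (weighted k.+1) (weighted_rate k t * weighted k t).
Proof.
move=> st; apply: (is_derive_eq (weighted_derive_gen k.+1 st)).
rewrite /weighted_rate /weighted expRB.
by field; rewrite gt_eqF// expR_gt0.
Qed.

Variable m : nat.
Hypothesis Am : A `<=` [set w | Xt s w = m].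

Let q_init j : q (m + j.+1)%N s = 0.
Proof.
rewrite /marginal (_ : _ `&` _ = set0) ?measure0//.
apply/seteqP; split => // w [/Am /= -> /eqP].
by rewrite -{1}[m]addn0 eqn_add2l.
Qed.

Let q_before k t : (k < m)%N -> s <= t -> q k t = 0.
Proof.
move=> km st; rewrite /marginal (_ : _ `&` _ = set0) ?measure0//.
apply/seteqP; split => // w [/Am /= Xm Xk].
by have := Xt_le w st; rewrite Xm Xk leqNgt km.
Qed.

(** No mass lies below [m] after time [s], so level [m] has no inflow, and the exponential weight
    exactly offsets its outflow. *)
Let weighted_m t : s <= t <= 1 -> weighted m t = weighted m s.
Proof.
move=> /andP[st t1].
have dz u : s < u < t -> is_derive u 1 (weighted m) 0.
  move=> /andP[su ut]; have u1 : s < u < 1 by rewrite su (lt_le_trans ut t1).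
  apply: (is_derive_eq (weighted_derive_gen m u1)).
  case: m q_before => [|k] qb; rewrite ?mul0r// qb ?mulr0 ?mul0r//.
  exact: ltW.
have cw : {within `[s, t], continuous (weighted m)}.
  by apply: continuous_subspaceW (@weighted_continuous m); apply: subset_itvl; rewrite bnd_simp.
apply/eqP; rewrite eq_le; apply/andP; split; last first.
  exact: (@ler_of_derive _ _ (fun=> 0)).
rewrite -lerN2; apply: (@ler_of_derive _ (fun x => - weighted m x) (fun=> 0)) => //.
  apply: within_continuous_pcomp cw => x; exact: opp_continuous.
move=> u su; have h := is_deriveN (@dz u su); apply: (is_derive_eq h); exact: oppr0.
Qed.

Variables (rho rho' : R -> R) (c : nat -> R).
Hypothesis rho_derive : forall t : R, is_derive t 1 rho (rho' t).
Hypothesis rho'_ge0 : forall t, 0 <= rho' t.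
Hypothesis c_ge0 : forall j, 0 <= c j.

Let rho_cont : {within `[s, 1], continuous rho}.
Proof. by apply: derivable_within_continuous => x _; case: (rho_derive x). Qed.

Let v_derive j t : s < t < 1 -> is_derive t 1 (weighted (m + j.+1)%N)
  (weighted_rate (m + j)%N t * weighted (m + j)%N t).
Proof. by rewrite addnS; exact: weighted_derive. Qed.

Let v_init j : weighted (m + j.+1)%N s = 0.
Proof. by rewrite /weighted q_init mul0r. Qed.

Let v_zero t : s <= t <= 1 -> weighted (m + 0)%N t = weighted m s.
Proof. by rewrite addn0; exact: weighted_m. Qed.

Let v_ge0 k t : 0 <= weighted k t.
Proof. by rewrite mulr_ge0 ?marginal_ge0 ?expR_ge0. Qed.

(** The chain starts at level [m] at time [s]. It serves with [m = 0] and [s = 0] for the way up to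
    an intermediate level, and with [A] fixing [X_s = m] for the way from there. *)
Lemma weighted_upper : (forall j t, 0 < t < 1 -> weighted_rate j t <= c j * rho' t) ->
  forall j t, s <= t <= 1 -> weighted (m + j)%N t <=
    weighted m s * (\prod_(i < j) c (m + i)%N) * simplex rho s j t.
Proof.
move=> wc; apply: (chain_upper (rho' := rho') rho_cont (fun t _ => rho_derive t)
  (fun t _ => rho'_ge0 t) (v := fun j => weighted (m + j)%N)
  (w := fun j => weighted_rate (m + j)%N) (c := fun i => c (m + i)%N)) => //.
- by move=> j; exact: weighted_continuous.
- by move=> j t /andP[st t1]; apply: wc; rewrite t1 (le_lt_trans s_ge0 st).
Qed.

Lemma weighted_lower : (forall j t, 0 < t < 1 -> c j * rho' t <= weighted_rate j t) ->
  forall j t, s <= t <= 1 ->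
    weighted m s * (\prod_(i < j) c (m + i)%N) * simplex rho s j t <= weighted (m + j)%N t.
Proof.
move=> wc; apply: (chain_lower (rho' := rho') rho_cont (fun t _ => rho_derive t)
  (fun t _ => rho'_ge0 t) (v := fun j => weighted (m + j)%N)
  (w := fun j => weighted_rate (m + j)%N) (c := fun i => c (m + i)%N)) => //.
- by move=> j; exact: weighted_continuous.
- by move=> j t /andP[st t1]; apply: wc; rewrite t1 (le_lt_trans s_ge0 st).
Qed.

End ForwardEquation.

(** * The bridge *)

Section Intensity.
Variables (R : realType) (l dl : R -> nat -> R).
Hypothesis HC1 : C1_on01 l dl.

Lemma C1_on01_continuous z : {within `[0, 1], continuous (l ^~ z)}.
Proof.
apply: within_continuous_eps => t t01 e e0.
have [_ /(_ t t01)/cvgrPdist_lt/(_ 1 ltr01)] := HC1 z.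
move=> [d /= d0 Hd]; have M0 : 0 < `|dl t z| + 1 by rewrite ltr_wpDl.
exists (Num.min d (e / (`|dl t z| + 1))); first by rewrite lt_min d0 divr_gt0.
move=> u u01; rewrite lt_min => /andP[ud ue].
case: (eqVneq u t) => [->|ut]; first by rewrite subrr normr0.
have ut0 : u - t != 0 by rewrite subr_eq0.
have := Hd (u - t); rewrite /= sub0r normrN => /(_ ud ut0).
rewrite (_ : t + (u - t) = u); last by ring.
move=> /(_ u01) H.
have {}H : `|(u - t)^-1 * (l u z - l t z)| < `|dl t z| + 1.
  rewrite -ltrBlDl; apply: le_lt_trans H; rewrite distrC.
  exact: le_trans (ler_norm _) (ler_dist_dist _ _).
move: H; rewrite normrM normfV ltr_pdivrMl ?normr_gt0// => H.
by rewrite distrC (lt_le_trans H)// -ler_pdivlMr// ltW.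
Qed.

Lemma C1_on01_derive z (t : R) : 0 < t < 1 -> is_derive t 1 (l ^~ z) (dl t z).
Proof.
move=> /andP[t0 t1]; apply: is_derive_cvg.
have t01 : 0 <= t <= 1 by rewrite !ltW.
have [_ /(_ t t01) H] := HC1 z.
apply: cvg_trans H => S; rewrite /= /within/= => -[d /= d0 Hd].
exists (Num.min d (Num.min t (1 - t))); first by rewrite /= !lt_min d0 t0 subr_gt0.
move=> h /=; rewrite sub0r normrN !lt_min => /andP[hd /andP[ht h1]] h0.
apply: Hd => //=; rewrite ?sub0r ?normrN//.
move: ht h1; rewrite !ltr_norml => /andP[? ?] /andP[? ?]; apply/andP; split; lra.
Qed.

Hypothesis l_gt0 : forall t z, 0 <= t <= 1 -> 0 < l t z.

(** The intercept is the maximum of [l ^~ 0] over [[0, 1]], the slope the bound on the increments in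
    [z]. *)
Lemma intensity_affine_bound :
  (exists C : R, forall t z, 0 <= t <= 1 -> `|l t z.+1 - l t z| <= C) ->
  exists CD : R * R, [/\ 0 <= CD.1, 0 <= CD.2 &
    forall t z, 0 <= t <= 1 -> l t z <= CD.2 + CD.1 * z%:R].
Proof.
move=> [C HC]; have [x x01 Hx] := EVT_max ler01 (@C1_on01_continuous 0%N).
have h01 : 0 <= (0 : R) <= 1 by rewrite lexx ler01.
have C0 : 0 <= C by apply: le_trans (HC 0 0%N h01); exact: normr_ge0.
exists (C, l x 0%N); split => //=.
  by apply/ltW/l_gt0; move: x01; rewrite in_itv.
move=> t z t01; elim: z => [|z IH]; first by rewrite mulr0 addr0 Hx// in_itv.
have := le_trans (ler_norm _) (HC t z t01).
by rewrite -natr1 mulrDr mulr1; lra.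
Qed.

Definition Xi_dev (lam : R) (z : nat) : R :=
  sup ((fun t => `|Xi l dl t z - lam|) @` `[0, 1]).

(** On an unbounded set [sup] would be a meaningless default. Continuity of [dl] and [l] together
    with [l > 0] makes [Xi] continuous, hence bounded on [[0, 1]]. *)
Lemma Xi_dev_ub lam z t : 0 <= t <= 1 -> `|Xi l dl t z - lam| <= Xi_dev lam z.
Proof.
move=> t01.
have cX : {within `[0, 1], continuous (fun t => `|Xi l dl t z - lam|)}.
  apply: (@within_continuous_pcomp _ _ (fun x : R => `|x|)); first exact: norm_continuous.
  apply/subspace_continuousP => x x01.
  have x01' : 0 <= x <= 1 by move: x01; rewrite /= in_itv.
  have cl k := (subspace_continuousP _ _).1 (@C1_on01_continuous k) x x01.
  have cdl := (subspace_continuousP _ _).1 (HC1 z).1 x x01.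
  apply: cvgB; last exact: cvg_cst.
  apply: cvgD; last by apply: cvgB; exact: cl.
  apply: cvgM => //; apply: cvgV; last exact: cl.
  by rewrite gt_eqF// l_gt0.
have [x x01 Hx] := EVT_max ler01 cX.
apply: ub_le_sup; last by exists t => //=; rewrite in_itv.
exists `|Xi l dl x z - lam| => _ [y /= y01 <-]; exact: Hx.
Qed.

Lemma Xi_dev_ge0 lam z : 0 <= Xi_dev lam z.
Proof.
have h01 : 0 <= (0 : R) <= 1 by rewrite lexx ler01.
by apply: le_trans (Xi_dev_ub lam z h01); exact: normr_ge0.
Qed.

Variables (C D : R).
Hypothesis l_le : forall t z, 0 <= t <= 1 -> l t z <= D + C * z%:R.

Let prim0 k : prim (l ^~ k) 0 = 0.
Proof. by rewrite /prim set_itv1 Rintegral_set1. Qed.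

(* The logarithmic derivative of [twist a k] is [Xi - a]. *)
Let twist a k t := l t k * expR (prim (l ^~ k.+1) t - prim (l ^~ k) t - a * t).

Let twist0 a k : twist a k 0 = l 0 k.
Proof. by rewrite /twist !prim0 subrr mulr0 subrr expR0 mulr1. Qed.

Let twistE a k t : twist a k t = weighted_rate l k t * expR (- (a * t)).
Proof. by rewrite /twist /weighted_rate expRD mulrA. Qed.

Let twist_cont a k t : t <= 1 -> {within `[0, t], continuous (twist a k)}.
Proof.
move=> t1; suff cT : {within `[0, 1], continuous (twist a k)}.
  by apply: continuous_subspaceW cT; apply: subset_itvl; rewrite bnd_simp.
apply: within_continuous_pmul; first exact: C1_on01_continuous.
have cL j : {within `[0, 1], continuous (prim (l ^~ j))}.
  apply: (@within_continuous_lipschitz _ _ _ _ (D + C * j%:R)) => x y x0 xy y1.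
  have /andP[h1 h2] := rate_prim_bounds (@C1_on01_continuous) l_gt0 l_le j x0 xy y1.
  by rewrite ger0_norm.
apply: within_continuous_pcomp; first exact: continuous_expR.
apply: within_continuous_psub; first by apply: within_continuous_psub; exact: cL.
apply/subspace_continuousP => x _; apply: cvg_within_filter.
exact: mulrl_continuous.
Qed.

Let twist_derive a k (t : R) : 0 < t < 1 ->
  is_derive t 1 (twist a k) (twist a k t * (Xi l dl t k - a)).
Proof.
move=> t01; have t01' : 0 <= t <= 1 by case/andP: t01 => /ltW -> /ltW ->.
have lt0 := l_gt0 k t01'.
have dL j := rate_prim_derive (@C1_on01_continuous) j t01.
have h := is_derive_pmul (C1_on01_derive k t01) (is_derive_pexp
  (is_derive_psub (is_derive_psub (dL k.+1) (dL k)) (is_derive_pscale a (is_derive_id t 1)))).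
apply: (is_derive_eq h); rewrite /twist /Xi /=.
move: (expR _) => E; field; by rewrite gt_eqF.
Qed.

(** If [Xi <= a], then [twist a k] is nonincreasing, and it starts at [l 0 k]. *)
Lemma weighted_rate_le a k t : 0 < t < 1 -> (forall x, 0 <= x <= 1 -> Xi l dl x k <= a) ->
  weighted_rate l k t <= l 0 k * expR (a * t).
Proof.
move=> /andP[t0 t1] H.
have : - twist a k 0 <= - twist a k t.
  apply: (@ler_of_derive _ (fun x => - twist a k x)
    (fun x => - (twist a k x * (Xi l dl x k - a)))); first exact: ltW.
  - apply: (@within_continuous_pcomp _ _ -%R) (@twist_cont a k t (ltW t1)) => x.
    exact: opp_continuous.
  - move=> x /andP[x0 xt]; apply: is_deriveN; apply: twist_derive.
    by rewrite x0 (lt_trans xt t1).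
  move=> x /andP[x0 xt]; have x01 : 0 <= x <= 1 by rewrite (ltW x0) (ltW (lt_trans xt t1)).
  rewrite oppr_ge0 mulr_ge0_le0 ?subr_le0 ?H// mulr_ge0 ?expR_ge0//.
  exact/ltW/l_gt0.
rewrite lerN2 twist0 twistE expRN -ler_pdivlMr ?invr_gt0 ?expR_gt0//.
by rewrite invrK.
Qed.

Lemma weighted_rate_ge a k t : 0 < t < 1 -> (forall x, 0 <= x <= 1 -> a <= Xi l dl x k) ->
  l 0 k * expR (a * t) <= weighted_rate l k t.
Proof.
move=> /andP[t0 t1] H.
have : twist a k 0 <= twist a k t.
  apply: (@ler_of_derive _ _ (fun x => twist a k x * (Xi l dl x k - a))); first exact: ltW.
  - exact: twist_cont (ltW t1).
  - by move=> x /andP[x0 xt]; apply: twist_derive; rewrite x0 (lt_trans xt t1).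
  move=> x /andP[x0 xt]; have x01 : 0 <= x <= 1 by rewrite (ltW x0) (ltW (lt_trans xt t1)).
  rewrite mulr_ge0 ?subr_ge0 ?H// mulr_ge0 ?expR_ge0//.
  exact/ltW/l_gt0.
rewrite twist0 twistE expRN ler_pdivlMr ?expR_gt0//.
Qed.

(** The factor [exp(d_k t)] is enlarged to [exp(d_k)] so that level and time separate, the form
    [c j * rho' t] that the chain comparison asks for. *)
Lemma weighted_rate_upper lam k t : 0 < t < 1 ->
  weighted_rate l k t <= l 0 k * expR (Xi_dev lam k) * expR (lam * t).
Proof.
move=> t01; have d0 := Xi_dev_ge0 lam k; have /andP[t0 t1] := t01.
have l00 : 0 <= l 0 k by apply/ltW/l_gt0; rewrite lexx ler01.
apply: (le_trans (@weighted_rate_le (lam + Xi_dev lam k) k t t01 _)).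
  move=> x x01; have := le_trans (ler_norm _) (Xi_dev_ub lam k x01); lra.
rewrite -mulrA ler_wpM2l// -expRD ler_expR.
have : Xi_dev lam k * t <= Xi_dev lam k by rewrite ler_piMr// ltW.
by lra.
Qed.

Lemma weighted_rate_lower lam k t : 0 < t < 1 ->
  l 0 k * expR (- Xi_dev lam k) * expR (lam * t) <= weighted_rate l k t.
Proof.
move=> t01; have d0 := Xi_dev_ge0 lam k; have /andP[t0 t1] := t01.
have l00 : 0 <= l 0 k by apply/ltW/l_gt0; rewrite lexx ler01.
apply: le_trans (@weighted_rate_ge (lam - Xi_dev lam k) k t t01 _); last first.
  move=> x x01; have := Xi_dev_ub lam k x01; rewrite ler_norml => /andP[]; lra.
rewrite -mulrA ler_wpM2l// -expRD ler_expR.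
have : Xi_dev lam k * t <= Xi_dev lam k by rewrite ler_piMr// ltW.
by lra.
Qed.

End Intensity.

(** * The limiting profile as a normalised clock *)

Section Rho.
Variable R : realType.
Implicit Types lam t : R.

(** The primitive of [exp(lam t)] vanishing at 0; divided by its value at 1 it is [pi_lam]. *)
Definition rho lam t : R := if lam == 0 then t else (expR (lam * t) - 1) / lam.

Lemma rho_derive lam t : is_derive t 1 (rho lam) (expR (lam * t)).
Proof.
case: (eqVneq lam 0) => [->|lam0].
  rewrite mul0r expR0 (_ : rho 0 = id); first exact: is_derive_id.
  by apply/funext => x; rewrite /rho eqxx.
rewrite (_ : rho lam = fun x => lam^-1 * (expR (lam * x) - 1)); last first.
  by apply/funext => x; rewrite /rho (negbTE lam0) mulrC.
have h := is_derive_pscale lam^-1 (is_derive_psub (is_derive_pexp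
  (is_derive_pscale lam (is_derive_id t 1))) (is_derive_pcst 1 t)).
by apply: (is_derive_eq h); field.
Qed.

Lemma rho_0 lam : rho lam 0 = 0.
Proof. by rewrite /rho; case: ifP => // _; rewrite mulr0 expR0 subrr mul0r. Qed.

Lemma rho_le lam s t : s <= t -> rho lam s <= rho lam t.
Proof.
move=> st; apply: (@ler_of_derive _ _ (fun t => expR (lam * t))) => //.
- by apply: derivable_within_continuous => x _; case: (rho_derive lam x).
- by move=> x _; exact: rho_derive.
Qed.

Lemma rho1_gt0 lam : 0 < rho lam 1.
Proof.
rewrite /rho; case: (ltgtP lam 0) => [h|h|_]; rewrite ?mulr1 ?ltr01//.
  by rewrite ltr_ndivlMr// mul0r subr_lt0 expR_lt1.
by rewrite divr_gt0// subr_gt0 expR_gt1.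
Qed.

Lemma pi_lamE lam t : pi_lam lam t = rho lam t / rho lam 1.
Proof.
rewrite /pi_lam /rho; case: (eqVneq lam 0) => [_|lam0]; first by rewrite divr1.
have h : expR lam - 1 != 0.
  have := rho1_gt0 lam; rewrite /rho (negbTE lam0) mulr1.
  by apply: contraTneq => ->; rewrite mul0r ltxx.
by rewrite mulr1; field; rewrite lam0.
Qed.

Lemma pi_lam_0 lam : pi_lam lam 0 = 0. Proof. by rewrite pi_lamE rho_0 mul0r. Qed.

Lemma pi_lam_1 lam : pi_lam lam 1 = 1.
Proof. by rewrite pi_lamE divff// gt_eqF// rho1_gt0. Qed.

Lemma pi_lam_le lam s t : s <= t -> pi_lam lam s <= pi_lam lam t.
Proof. by move=> st; rewrite !pi_lamE ler_pM2r ?invr_gt0 ?rho1_gt0// rho_le. Qed.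

Lemma pi_lam01 lam t : 0 <= t <= 1 -> 0 <= pi_lam lam t <= 1.
Proof.
by move=> /andP[t0 t1]; rewrite -{1}(pi_lam_0 lam) -(pi_lam_1 lam) !pi_lam_le.
Qed.

Lemma pi_lam_continuous lam : continuous (pi_lam lam).
Proof.
move=> t; rewrite (_ : pi_lam lam = fun x => rho lam x * (rho lam 1)^-1); last first.
  by apply/funext => x; exact: pi_lamE.
apply: cvgM; last exact: cvg_cst.
by apply/differentiable_continuous/derivable1_diffP; case: (rho_derive lam t).
Qed.

End Rho.

(** * An exponential tail bound for the binomial law *)

Section Chernoff.
Variable R : realType.

Definition binomial_weight (p : R) (N m : nat) : R :=
  'C(N, m)%:R * p ^+ m * (1 - p) ^+ (N - m).

(** From [1 - x / 2 <= exp(- x / 2)], [exp x] is at most [(1 - x / 2)^-2]. The comparison with the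
    quadratic comes down to [1 - 3 x + x^2 >= 0], which [x <= 1/4] ensures. *)
Lemma expR_le_quadratic (x : R) : x <= 4^-1 -> expR x <= 1 + x + x ^+ 2.
Proof.
move=> x4; have h : 1 - x / 2 <= expR (- (x / 2)) by exact: expR_ge1Dx.
have h0 : 0 < 1 - x / 2 by lra.
have e0 := expR_gt0 (x / 2).
have h1 : expR (x / 2) <= (1 - x / 2)^-1.
  by rewrite -[expR _]invrK -expRN lef_pV2 ?posrE ?expR_gt0.
rewrite [X in expR X](_ : x = x / 2 + x / 2); last by field.
rewrite expRD; apply: (@le_trans _ _ ((1 - x / 2)^-1 * (1 - x / 2)^-1)).
  by rewrite ler_pM// ltW.
rewrite -invfM -[X in X <= _]mul1r ler_pdivrMr ?mulr_gt0//.
rewrite -subr_ge0 (_ : _ - 1 = x ^+ 2 / 4 * (1 - 3 * x + x ^+ 2)); last by field.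
rewrite mulr_ge0 ?divr_ge0 ?sqr_ge0//.
have := sqr_ge0 x; lra.
Qed.

(** The variable is centred, so linear terms cancel and the quadratic bound leaves
    [1 + x^2 p (1 - p)], at most [1 + x^2]. *)
Lemma bernoulli_mgf (p x : R) : 0 <= p <= 1 -> `|x| <= 4^-1 ->
  p * expR (x * (1 - p)) + (1 - p) * expR (- (x * p)) <= expR (x ^+ 2).
Proof.
move=> /andP[p0 p1]; rewrite ler_norml => /andP[x1 x2].
have h1 : expR (x * (1 - p)) <= 1 + x * (1 - p) + (x * (1 - p)) ^+ 2.
  by apply: expR_le_quadratic; nra.
have h2 : expR (- (x * p)) <= 1 + - (x * p) + (- (x * p)) ^+ 2.
  by apply: expR_le_quadratic; nra.
apply: le_trans (expR_ge1Dx _).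
have h1' := ler_wpM2l p0 h1.
have p1' : 0 <= 1 - p by lra.
have h2' := ler_wpM2l p1' h2.
apply: (le_trans (lerD h1' h2')).
rewrite -subr_ge0 (_ : _ - _ = x ^+ 2 * (1 - p * (1 - p))); last by ring.
by rewrite mulr_ge0 ?sqr_ge0//; nra.
Qed.

Lemma binomial_mgf (p x : R) N : 0 <= p <= 1 -> `|x| <= 4^-1 ->
  \sum_(m < N.+1) binomial_weight p N m * expR (x * (m%:R - N%:R * p)) <= expR (N%:R * x ^+ 2).
Proof.
move=> p01 x4; have /andP[p0 p1] := p01.
rewrite (_ : \sum_(m < N.+1) _ =
    ((1 - p) * expR (- (x * p)) + p * expR (x * (1 - p))) ^+ N); last first.
  rewrite exprDn; apply: eq_bigr => i _; rewrite /binomial_weight -mulr_natl.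
  have iN : (i <= N)%N by rewrite -ltnS.
  rewrite !exprMn -!expRM_natl.
  rewrite (_ : x * (i%:R - N%:R * p) = (N - i)%:R * - (x * p) + i%:R * (x * (1 - p))).
    by rewrite expRD; ring.
  by rewrite natrB//; ring.
rewrite expRM_natl; apply: lerXn2r; rewrite ?nnegrE ?expR_ge0//.
  by rewrite addr_ge0 ?mulr_ge0 ?expR_ge0// subr_ge0.
by rewrite [X in X <= _]addrC; exact: bernoulli_mgf.
Qed.

Lemma binomial_weight_ge0 (p : R) N m : 0 <= p <= 1 -> 0 <= binomial_weight p N m.
Proof. by move=> /andP[p0 p1]; rewrite !mulr_ge0// exprn_ge0// subr_ge0. Qed.

Lemma binomial_chernoff (p e : R) N : 0 <= p <= 1 -> 0 <= e <= 1 ->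
  \sum_(m < N.+1 | N%:R * e <= `|m%:R - N%:R * p|) binomial_weight p N m <=
  2 * expR (- (3 / 16 * e ^+ 2 * N%:R)).
Proof.
(* [e <= 1] puts [x] within the range of [binomial_mgf]; the exponent [- x e + x^2] per trial is
   then [- 3/16 e^2]. The factor 2 counts the two tails, taken with [x] and [- x]. *)
move=> p01 /andP[e0 e1]; pose x := e / 4.
have x4 : `|x| <= 4^-1 by rewrite ger0_norm /x; lra.
have x4' : `|- x| <= 4^-1 by rewrite normrN.
pose F y m := binomial_weight p N m * expR (y * (m%:R - N%:R * p)).
apply: (@le_trans _ _ (\sum_(m < N.+1) expR (- (x * (N%:R * e))) * (F x m + F (- x) m))).
  rewrite big_mkcond; apply: ler_sum => m _.
  have b0 := binomial_weight_ge0 N m p01.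
  case: ifP => [h|_]; last by rewrite /F mulr_ge0 ?expR_ge0// addr_ge0// mulr_ge0 ?expR_ge0.
  rewrite /F -mulrDr mulrCA ler_peMr// mulrDr -!expRD.
  have x0 : 0 <= x by rewrite /x; lra.
  case: (leP 0 (m%:R - N%:R * p)) => s0; move: h.
    rewrite ger0_norm// => h; rewrite ler_wpDr ?expR_ge0// -[X in X <= _]expR0 ler_expR.
    by rewrite addrC subr_ge0; exact: ler_wpM2l.
  rewrite ltr0_norm// => h; rewrite ler_wpDl ?expR_ge0// -[X in X <= _]expR0 ler_expR.
  by rewrite addrC subr_ge0 mulNr -mulrN; exact: ler_wpM2l.
rewrite -mulr_sumr big_split/=.
have m1 := binomial_mgf N p01 x4; have m2 := binomial_mgf N p01 x4'.
rewrite sqrrN in m2.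
apply: (@le_trans _ _ (expR (- (x * (N%:R * e))) * (2 * expR (N%:R * x ^+ 2)))).
  rewrite ler_wpM2l ?expR_ge0//; move: m1 m2; rewrite /F; lra.
rewrite mulrCA ler_wpM2l// -expRD ler_expR /x.
by rewrite le_eqVlt; apply/orP; left; apply/eqP; field.
Qed.

End Chernoff.

(** * Bridge marginals against the binomial law *)

Lemma fine_probability_bigsetU_le d (T : measurableType d) (R : realType)
    (P : probability T R) (I : Type) (r : seq I) (Q : pred I) (F : I -> set T) :
  (forall i, measurable (F i)) ->
  fine (P (\big[setU/set0]_(i <- r | Q i) F i)) <= \sum_(i <- r | Q i) fine (P (F i)).
Proof.
move=> mF; elim: r => [|i r IH]; first by rewrite !big_nil measure0.
rewrite !big_cons; case: ifP => // Qi.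
have mU : measurable (\big[setU/set0]_(i <- r | Q i) F i) by exact: bigsetU_measurable.
apply: le_trans (lerD (lexx _) IH).
rewrite -fineD ?fin_num_measure// fine_le ?fin_num_measure//; first exact: measurableU.
  by rewrite fin_numD !fin_num_measure.
exact: measureU2.
Qed.

(** The product of the simplex volumes before and after [s] is the full volume times the probability
    that exactly [m] of [m + k] uniform points of a length [y] fall in the first [x]. *)
Lemma binomial_weight_ratio (R : realType) (x y : R) (m k : nat) : y != 0 ->
  x ^+ m / m`!%:R * ((y - x) ^+ k / k`!%:R) =
  binomial_weight (x / y) (m + k) m * (y ^+ (m + k) / (m + k)`!%:R).
Proof.
move=> y0; have := @bin_fact (m + k) m (leq_addr _ _); rewrite addKn => /(congr1 (fun n => n%:R : R)).
rewrite !natrM /binomial_weight addKn (_ : 1 - x / y = (y - x) / y); last by field.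
rewrite !expr_div_n exprD => <-.
have f0 n : n`!%:R != 0 :> R by rewrite pnatr_eq0 -lt0n fact_gt0.
have b0 : 'C(m + k, m)%:R != 0 :> R by rewrite pnatr_eq0 -lt0n bin_gt0 leq_addr.
move: (f0 m) (f0 k) b0 (expf_neq0 m y0) (expf_neq0 k y0).
move: (m`!%:R) (k`!%:R) ('C(_, _)%:R) (y ^+ m) (y ^+ k) (x ^+ m) ((y - x) ^+ k).
by move=> a b c u v g h a0 b0 c0 u0 v0; field; rewrite a0 b0 c0 u0 v0.
Qed.

Lemma measurable_bridge_event (R : realType) N : measurable (bridge_event N : set (Omega R)).
Proof.
apply: (@measurableI _ (Omega R) [set w | Xt 0 w = 0%N] [set w | Xt 1 w = N]);
  by apply: measurable_Xt_eq; rewrite lexx ler01.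
Qed.

Section Bridge.
Variables (R : realType) (P : probability (Omega R) R) (l dl : R -> nat -> R) (lam : R).
Hypothesis Pl : markov_counting P l.
Hypothesis HC1 : C1_on01 l dl.
Hypothesis l_gt0 : forall t z, 0 <= t <= 1 -> 0 < l t z.
Variables (C D : R).
Hypothesis C_ge0 : 0 <= C.
Hypothesis D_ge0 : 0 <= D.
Hypothesis l_le : forall t z, 0 <= t <= 1 -> l t z <= D + C * z%:R.
Hypothesis P0 : (0 < P [set w | Xt 0 w = 0%N])%E.

Let lc := C1_on01_continuous HC1.
Let dev := Xi_dev l dl lam.
Let A0 := [set w : Omega R | Xt 0 w = 0%N].
Let cu i := l 0 i * expR (dev i).
Let cl i := l 0 i * expR (- dev i).

Let h00 : 0 <= (0 : R) <= 1. Proof. by rewrite lexx ler01. Qed.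

Let cu_ge0 i : 0 <= cu i.
Proof. by rewrite mulr_ge0 ?expR_ge0//; exact/ltW/l_gt0. Qed.

Let cl_gt0 i : 0 < cl i.
Proof. by rewrite mulr_gt0 ?expR_gt0//; exact/l_gt0. Qed.

Let cl_ge0 i : 0 <= cl i. Proof. exact/ltW. Qed.

Let FA0 : Filt 0 A0. Proof. exact: Filt_Xt. Qed.

Let prod_cu n : \prod_(i < n) cu i = \prod_(i < n) cl i * expR (2 * \sum_(i < n) dev i).
Proof.
rewrite mulr_sumr expR_sum -big_split/=; apply: eq_bigr => i _.
by rewrite /cu /cl -mulrA -expRD; congr (_ * expR _); ring.
Qed.

Let upper s (A : set (Omega R)) m j t := fun s0 s1 FA (AA0 : A `<=` A0) Am st =>
  @weighted_upper R P l C D lc l_gt0 C_ge0 D_ge0 l_le Pl s s0 s1 A FA AA0 m Am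
  (rho lam) (fun t => expR (lam * t)) cu (rho_derive lam) (fun t => expR_ge0 (lam * t)) cu_ge0
  (fun j t t01 => weighted_rate_upper HC1 l_gt0 l_le lam j t01) j t st.

Let lower j := @weighted_lower R P l C D lc l_gt0 C_ge0 D_ge0 l_le Pl 0 (lexx 0) ler01
  A0 FA0 (@subset_refl _ _) 0%N (@subset_refl _ _)
  (rho lam) (fun t => expR (lam * t)) cl (rho_derive lam) (fun t => expR_ge0 (lam * t)) cl_ge0
  (fun j t t01 => weighted_rate_lower HC1 l_gt0 l_le lam j t01) j 1.

Let h11 : 0 <= (1 : R) <= 1. Proof. by rewrite lexx ler01. Qed.

Let w00 := weighted P l A0 0 0.

Let w00_gt0 : 0 < w00.
Proof.
rewrite mulr_gt0 ?expR_gt0// /marginal setIid fine_gt0// P0/= ltey_eq fin_num_measure//.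
exact: measurable_Xt_eq.
Qed.

Let lower1 N : w00 * (\prod_(i < N) cl i) * (rho lam 1 ^+ N / N`!%:R) <= weighted P l A0 N 1.
Proof. by have := lower N h11; rewrite /simplex rho_0 subr0. Qed.

Let weighted_bridge N : weighted P l A0 N 1 =
  fine (P (bridge_event N)) * expR (prim (l ^~ N) 1).
Proof. by []. Qed.

(** Ensures that [Pbridge] divides by a nonzero number; the lower chain bound is strictly
    positive. *)
Lemma bridge_gt0 N : 0 < fine (P (bridge_event N)).
Proof.
have := lower1 N; rewrite weighted_bridge => h.
rewrite -(pmulr_lgt0 _ (expR_gt0 (prim (l ^~ N) 1))); apply: lt_le_trans h.
apply: mulr_gt0; first by apply: mulr_gt0 => //; apply: prodr_gt0.
by apply: divr_gt0; [rewrite exprn_gt0// rho1_gt0|rewrite ltr0n fact_gt0].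
Qed.

(** Two upper chains are joined, from 0 to [m] over [[0, s]] and from [m] to [m + k] over [[s, 1]];
    the end value of the first is the initial value of the second. The lower chain over [[0, 1]]
    bounds the bridge event. Both sides carry the same exponential weight at time 1, which
    cancels. *)
Lemma bridge_ratio s m k : 0 <= s <= 1 ->
  fine (P ([set w | Xt s w = m] `&` bridge_event (m + k))) <=
  expR (2 * \sum_(i < m + k) dev i) * binomial_weight (pi_lam lam s) (m + k) m *
    fine (P (bridge_event (m + k))).
Proof.
move=> s01; have /andP[s0 s1] := s01.
pose A := A0 `&` [set w : Omega R | Xt s w = m].
have FA : Filt s A by apply: Filt_setI; [exact: Filt_Xt|exact: Filt_Xt].
have u1 := @upper s A m k 1 s0 s1 FA (@subIsetl _ _ _) (@subIsetr _ _ _).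
rewrite s1 lexx in u1; have {}u1 := u1 isT.
have u0 := @upper 0 A0 0%N m s (lexx 0) ler01 FA0 (@subset_refl _ _) (@subset_refl _ _) s01.
have WA : weighted P l A m s = weighted P l A0 m s.
  by rewrite /weighted /marginal /A -setIA setIid.
have WN : weighted P l A (m + k) 1 =
    fine (P ([set w | Xt s w = m] `&` bridge_event (m + k))) * expR (prim (l ^~ (m + k)%N) 1).
  rewrite /weighted /marginal /A; congr (fine (P _) * _).
  by apply/seteqP; split => w /=; rewrite /bridge_event/=; tauto.
have r1 := rho1_gt0 lam.
rewrite -(ler_pM2r (expR_gt0 (prim (l ^~ (m + k)%N) 1))) -WN.
apply: (le_trans u1); rewrite WA.
have s_ge0 : 0 <= simplex (rho lam) s k 1.
  by rewrite divr_ge0// exprn_ge0// subr_ge0 rho_le.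
have p_ge0 : 0 <= \prod_(i < k) cu (m + i) by apply: prodr_ge0.
apply: (@le_trans _ _ (w00 * (\prod_(i < m) cu i) * simplex (rho lam) 0 m s *
    (\prod_(i < k) cu (m + i)) * simplex (rho lam) s k 1)).
  by rewrite ler_wpM2r// ler_wpM2r.
rewrite -[X in _ <= X]mulrA -weighted_bridge.
have bw_ge0 : 0 <= expR (2 * \sum_(i < m + k) dev i) * binomial_weight (pi_lam lam s) (m + k) m.
  by rewrite mulr_ge0 ?expR_ge0// binomial_weight_ge0// pi_lam01.
apply: le_trans (ler_wpM2l bw_ge0 (lower1 (m + k))).
rewrite /simplex rho_0 subr0.
have -> : w00 * (\prod_(i < m) cu i) * (rho lam s ^+ m / m`!%:R) *
    (\prod_(i < k) cu (m + i)) * ((rho lam 1 - rho lam s) ^+ k / k`!%:R) =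
  w00 * (\prod_(i < m + k) cu i) *
    (rho lam s ^+ m / m`!%:R * ((rho lam 1 - rho lam s) ^+ k / k`!%:R)).
  by rewrite big_split_ord/=; ring.
rewrite binomial_weight_ratio ?gt_eqF// -pi_lamE prod_cu.
by rewrite le_eqVlt; apply/orP; left; apply/eqP; ring.
Qed.

(** On the bridge event [X_s <= N], so the deviation event is a finite union over the values [m] of
    [X_s], and the binomial tail bounds the sum. *)
Lemma bridge_deviation s N (e : R) : 0 <= s <= 1 -> 0 < e <= 1 -> (0 < N)%N ->
  fine (P ([set w | e <= `|(Xt s w)%:R / N%:R - pi_lam lam s|] `&` bridge_event N)) <=
  2 * expR (2 * \sum_(i < N) dev i - 3 / 16 * e ^+ 2 * N%:R) * fine (P (bridge_event N)).
Proof.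
move=> s01 /andP[e0 e1] N0; have /andP[s0 s1] := s01.
have N0' : 0 < N%:R :> R by rewrite ltr0n.
have mb := @measurable_bridge_event R N.
pose F (m : 'I_N.+1) := [set w : Omega R | Xt s w = m] `&` bridge_event N.
have mF m : measurable (F m) by apply: measurableI => //; exact: measurable_Xt_eq.
have bad x : (e <= `|x / N%:R - pi_lam lam s|) = (N%:R * e <= `|x - N%:R * pi_lam lam s|).
  rewrite -[LHS](ler_pM2l N0') -[X in _ <= X * _](ger0_norm (ltW N0')) -normrM mulrBr.
  by rewrite [_ * (x / _)]mulrCA divff ?gt_eqF// mulr1.
have sub : [set w | e <= `|(Xt s w)%:R / N%:R - pi_lam lam s|] `&` bridge_event N `<=`
    \big[setU/set0]_(m < N.+1 | N%:R * e <= `|m%:R - N%:R * pi_lam lam s|) F m.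
  move=> w [/=]; rewrite bad => h wb; have [_ X1] := wb.
  have XN : (Xt s w < N.+1)%N by rewrite ltnS -X1 Xt_le.
  by rewrite (bigD1 (Ordinal XN))//=; left.
have mbad : measurable ([set w : Omega R | e <= `|(Xt s w)%:R / N%:R - pi_lam lam s|] `&` bridge_event N).
  apply: measurableI => //.
  exact: (measurable_Xt_set (fun j => is_true (e <= `|j%:R / N%:R - pi_lam lam s|)) s01).
apply: (le_trans (fine_probability_le P mbad _ sub)).
  by apply: bigsetU_measurable.
apply: (le_trans (fine_probability_bigsetU_le _ _ _ mF)).
apply: (@le_trans _ _ (\sum_(m < N.+1 | N%:R * e <= `|m%:R - N%:R * pi_lam lam s|)
   expR (2 * \sum_(i < N) dev i) * fine (P (bridge_event N)) * binomial_weight (pi_lam lam s) N m)).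
  apply: ler_sum => m _; have mN : (m <= N)%N by rewrite -ltnS.
  have := bridge_ratio m (N - m) s01; rewrite subnKC// => /le_trans; apply.
  by rewrite mulrAC.
rewrite -mulr_sumr; have e01 : 0 <= e <= 1 by rewrite (ltW e0).
have E0 : 0 <= expR (2 * \sum_(i < N) dev i) * fine (P (bridge_event N)).
  by rewrite mulr_ge0 ?expR_ge0// fine_ge0.
apply: (le_trans (ler_wpM2l E0 (binomial_chernoff N (pi_lam01 lam s01) e01))).
by rewrite expRD le_eqVlt; apply/orP; left; apply/eqP; ring.
Qed.

End Bridge.

(** * Uniformity in time and measurability of the supremum *)

Section Uniform.
Variables (R : realType) (lam : R).

Let Mpi := expR `|lam| / rho lam 1.

Lemma pi_lam_lip s t : 0 <= s -> s <= t -> t <= 1 ->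
  pi_lam lam t - pi_lam lam s <= Mpi * (t - s).
Proof.
move=> s0 st t1; rewrite !pi_lamE -mulrBl /Mpi mulrAC ler_pM2r ?invr_gt0 ?rho1_gt0//.
suff : expR `|lam| * s - rho lam s <= expR `|lam| * t - rho lam t by lra.
apply: (@ler_of_derive _ (fun x => expR `|lam| * x - rho lam x)
  (fun x => expR `|lam| * 1 - expR (lam * x))) => //.
- by apply: derivable_within_continuous => x _;
    have [] := is_derive_psub (is_derive_pscale (expR `|lam|) (is_derive_id x 1)) (rho_derive lam x).
- move=> x _; exact: is_derive_psub (is_derive_pscale _ (is_derive_id x 1)) (rho_derive lam x).
- move=> x /andP[sx xt]; rewrite mulr1 subr_ge0 ler_expR.
  apply: (le_trans (ler_norm _)); rewrite normrM ler_piMr// ger0_norm; lra.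
Qed.

Lemma grid_cover n (t : R) : 0 <= t <= 1 ->
  exists2 i, (i < n.+1)%N & grid 0 1 n i <= t <= grid 0 1 n i.+1.
Proof.
move=> /andP[t0 t1].
suff H j : t <= grid 0 1 n j.+1 -> exists2 i, (i <= j)%N & grid 0 1 n i <= t <= grid 0 1 n i.+1.
  by have [|i] := H n; [rewrite gridn|exists i].
elim: j => [|j IH] tj; first by exists 0%N => //; rewrite grid0 t0.
case: (leP (grid 0 1 n j.+1) t) => h; first by exists j.+1 => //; rewrite h.
by have [i ij hi] := IH (ltW h); exists i => //; exact: leqW.
Qed.

Lemma exists_fine_grid (e : R) : 0 < e -> exists n, forall i, (i < n.+1)%N ->
  pi_lam lam (grid 0 1 n i.+1) - pi_lam lam (grid 0 1 n i) <= e.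
Proof.
move=> e0; have M0 : 0 <= Mpi by rewrite divr_ge0 ?expR_ge0// ltW// rho1_gt0.
exists (Num.bound (Mpi / e)) => i iN.
have g0 : 0 <= grid 0 1 (Num.bound (Mpi / e)) i :> R by apply: grid_ge.
have g1 : grid 0 1 (Num.bound (Mpi / e)) i.+1 <= 1 :> R by apply: grid_le.
apply: (le_trans (pi_lam_lip g0 (grid_leS _ _ ler01) g1)).
rewrite gridS subr0 mul1r ler_pdivrMr ?ltr0Sn// mulrC -ler_pdivrMr//.
have /ltW/le_trans : Mpi / e < (Num.bound (Mpi / e))%:R.
  by apply: archi_boundP; rewrite divr_ge0// ltW.
by apply; rewrite ler_nat.
Qed.

Variables (N : nat) (eps : R).
Hypothesis N_gt0 : (0 < N)%N.
Let N0 : 0 < N%:R :> R. Proof. by rewrite ltr0n. Qed.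
Let f (w : Omega R) t : R := `|(Xt t w)%:R / N%:R - pi_lam lam t|.

(** Between two grid points both the path and [pi_lam] are monotone. Deviations below [e] at both
    ends and a variation of [pi_lam] at most [e] keep the deviation in between at most [2 * e]. *)
Lemma sup_deviation_grid n (e : R) (w : Omega R) : 2 * e < eps ->
  (forall i, (i < n.+1)%N ->
    pi_lam lam (grid 0 1 n i.+1) - pi_lam lam (grid 0 1 n i) <= e) ->
  eps <= sup (f w @` `[0, 1]) -> exists2 i, (i < n.+2)%N & e <= f w (grid 0 1 n i).
Proof.
move=> e2 Hg Hs; apply: contrapT => Hn.
have H i : (i < n.+2)%N -> f w (grid 0 1 n i) < e.
  by move=> iN; rewrite ltNge; apply/negP => h; apply: Hn; exists i.
suff : sup (f w @` `[0, 1]) <= 2 * e by move=> h; move: (le_lt_trans (le_trans Hs h) e2); rewrite ltxx.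
apply: ge_sup; first by exists (f w 0); exists 0 => //=; rewrite in_itv/= lexx ler01.
move=> r [t /= t01 <-]; rewrite in_itv/= in t01.
have [i iN /andP[it ti]] := grid_cover n t01.
have := H i (ltnW (iN : (i.+1 < n.+2)%N)); have := H i.+1 iN; have := Hg i iN.
have := pi_lam_le lam it; have := pi_lam_le lam ti.
have X1 : (Xt (grid 0 1 n i) w)%:R / N%:R <= (Xt t w)%:R / N%:R :> R.
  by rewrite ler_pM2r ?invr_gt0// ler_nat Xt_le.
have X2 : (Xt t w)%:R / N%:R <= (Xt (grid 0 1 n i.+1) w)%:R / N%:R :> R.
  by rewrite ler_pM2r ?invr_gt0// ler_nat Xt_le.
move: X1 X2; rewrite /f.
move: ((Xt (grid 0 1 n i) w)%:R / N%:R) ((Xt t w)%:R / N%:R)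
  ((Xt (grid 0 1 n i.+1) w)%:R / N%:R) => x y z.
move: (pi_lam lam (grid 0 1 n i)) (pi_lam lam t) (pi_lam lam (grid 0 1 n i.+1)) => a b c.
move=> xy yz h1 h2 h3; rewrite ltr_norml => /andP[h4 h5]; rewrite ltr_norml => /andP[h6 h7].
by rewrite ler_norml; apply/andP; split; lra.
Qed.

(** Just to the right of [t] the path is constant and [pi_lam] barely moves, so a nearby rational
    works; the end point 1 is itself rational. *)
Lemma deviation_gt_rational (w : Omega R) t (c : R) : 0 <= t <= 1 -> c < f w t ->
  exists2 q : rat, 0 <= (ratr q : R) <= 1 & c < f w (ratr q).
Proof.
move=> /andP[t0]; rewrite le_eqVlt => /orP[/eqP ->|t1] cf.
  by exists 1; rewrite rmorph1// lexx ler01.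
have [d d0 Hd] := Xt_right_cst t w.
have fc : 0 < f w t - c by rewrite subr_gt0.
have /cvgrPdist_lt/(_ _ fc)[d' /= d'0 Hd'] := @pi_lam_continuous _ lam t.
pose b := Num.min 1 (Num.min (t + d) (t + d')).
have tb : t < b by rewrite /b !lt_min t1 !ltrDl d0.
have [q] := rat_in_itvoo tb; rewrite in_itv/= /b !lt_min => /and3P[tq q1 /andP[qd qd']].
exists q; first by rewrite (le_trans t0 (ltW tq)) ltW.
have := Hd' (ratr q); rewrite /= ltr_distl => h.
have {}h : `|pi_lam lam t - pi_lam lam (ratr q)| < f w t - c.
  by apply: h; apply/andP; split; lra.
rewrite /f (Hd _ (ltW tq) qd); move: h; rewrite /f.
set x := (_ / _); set p := pi_lam lam t; set p' := pi_lam lam _ => h.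
have : `|x - p| <= `|x - p'| + `|p - p'|.
  by rewrite [`|p - p'|]distrC (le_trans _ (ler_normD _ _))// subrKA.
by move: h; lra.
Qed.

(** The supremum reaches [eps] exactly when each [eps - 1 / (k + 1)] is exceeded at some rational
    time. Intersecting with the bridge event bounds the path by [N], which makes [sup] a genuine
    supremum. *)
Lemma measurable_sup_deviation :
  measurable ([set w | eps <= sup (f w @` `[0, 1])] `&` bridge_event N).
Proof.
have mb := @measurable_bridge_event R N.
pose G (k : nat) (q : rat) : set (Omega R) := if 0 <= (ratr q : R) <= 1 then
  [set w | eps - k.+1%:R^-1 < f w (ratr q)] else set0.
have mG k q : measurable (G k q).
  rewrite /G; case: ifP => // q01.
  exact: (measurable_Xt_set (fun j => is_true (eps - k.+1%:R^-1 < `|j%:R / N%:R - pi_lam lam (ratr q)|)) q01).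
rewrite (_ : _ `&` _ = (\bigcap_k \bigcup_q G k q) `&` bridge_event N).
  apply: measurableI => //; apply: bigcap_measurable => // k _.
  exact: bigcupT_measurable_rat.
apply/seteqP; split => w [hw wb]; split => //.
  move=> k _.
  have ne : f w @` `[0, 1] !=set0 by exists (f w 0); exists 0 => //=; rewrite in_itv/= lexx ler01.
  have lt_sup : eps - k.+1%:R^-1 < sup (f w @` `[0, 1]).
    by apply: lt_le_trans hw; rewrite ltrBlDr ltrDl invr_gt0 ltr0n.
  have [_ [t /= t01 <-] ht] := sup_gt ne lt_sup.
  rewrite in_itv/= in t01; have [q q01 hq] := deviation_gt_rational t01 ht.
  by exists q => //; rewrite /G q01.
have ub : has_ubound (f w @` `[0, 1]).
  exists 2 => y [t /= t01 <-]; rewrite in_itv/= in t01.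
  apply: (le_trans (ler_normB _ _)); have /andP[p0 p1] := pi_lam01 lam t01.
  rewrite (ger0_norm p0) ger0_norm ?divr_ge0//.
  have : (Xt t w)%:R / N%:R <= 1 :> R.
    by rewrite ler_pdivrMr// mul1r ler_nat; have [_ <-] := wb; apply: Xt_le; case/andP: t01.
  by lra.
rewrite /=; apply/ler_addgt0Pr => e e0.
have [k ke] : exists k : nat, k.+1%:R^-1 < e.
  by have [k] := ltr_add_invr e0; rewrite add0r; exists k.
have [q _] := hw k I; rewrite /G; case: ifP => // q01 /= hq.
have : f w (ratr q) <= sup (f w @` `[0, 1]).
  by apply: ub_le_sup => //; exists (ratr q) => //=; rewrite in_itv.
by move: hq ke; move: (k.+1%:R^-1) (f w _) (sup _) => x y z; lra.
Qed.

End Uniform.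

Unset Implicit Arguments.

Theorem theorem2p5 (R : realType) (P : probability (Omega R) R)
  (l dl : R -> nat -> R) (lam : R)
  (Hmarkov : markov_counting P l)
  (HC1 : C1_on01 l dl)
  (Hbounded : exists C : R, forall t z, 0 <= t <= 1 -> `|l t z.+1 - l t z| <= C)
  (Hpos : forall t z, 0 <= t <= 1 -> 0 < l t z)
  (Hinit : forall k : nat, (0 < P [set w | Xt 0 w = k])%E)
  (Hlim : (fun z : nat => sup ((fun t => `|Xi l dl t z - lam|) @` `[0, 1]))
            @ \oo --> (0 : R)) :
  forall eps : R, 0 < eps ->
    (fun N : nat =>
       Pbridge P N [set w | eps <=
         sup ((fun t => `|(Xt t w)%:R / N%:R - pi_lam lam t|) @` `[0, 1])])
      @ \oo --> (0 : R).
Proof.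
move=> eps eps0.
have [[C D] /= [C0 D0 lCD]] := intensity_affine_bound HC1 Hpos Hbounded.
pose dev := Xi_dev l dl lam.
(* [eps / 4] gives [2 * e < eps] for the grid argument; the cap 1 is required by the Chernoff
   bound. *)
pose e := Num.min (eps / 4) 1.
have e0 : 0 < e by rewrite lt_min ltr01 divr_gt0.
have e01 : 0 < e <= 1 by rewrite e0 ge_min lexx orbT.
have e_eps : 2 * e < eps.
  have : e <= eps / 4 by rewrite ge_min lexx.
  by move: (e) => x; lra.
have [n Hn] := exists_fine_grid lam e0.
pose c := 3 / 16 * e ^+ 2.
have c0 : 0 < c by rewrite !mulr_gt0// exprn_gt0.
(* The number of grid points, both ends included, times the 2 of the Chernoff bound. *)
pose K : R := n.+2%:R * 2.
have K0 : 0 < K by rewrite mulr_gt0// ltr0n.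
have Pgt0 := bridge_gt0 lam Hmarkov HC1 Hpos C0 D0 lCD (Hinit 0%N).
have bound N : (0 < N)%N -> 0 <= Pbridge P N [set w | eps <=
    sup ((fun t => `|(Xt t w)%:R / N%:R - pi_lam lam t|) @` `[0, 1])] <=
    K * expR (2 * \sum_(i < N) dev i - c * N%:R).
  move=> N0; have g01 (i : 'I_n.+2) : 0 <= (grid 0 1 n i : R) <= 1.
    by rewrite grid_ge//= grid_le// -ltnS.
  apply/andP; split; first by rewrite divr_ge0// fine_ge0.
  rewrite /Pbridge ler_pdivrMr//.
  pose F (i : 'I_n.+2) := [set w : Omega R | e <= `|(Xt (grid 0 1 n i) w)%:R / N%:R
    - pi_lam lam (grid 0 1 n i)|] `&` bridge_event N.
  have mF i : measurable (F i).
    apply: measurableI; last exact: measurable_bridge_event.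
    exact: (measurable_Xt_set (fun j =>
      is_true (e <= `|j%:R / N%:R - pi_lam lam (grid 0 1 n i)|)) (g01 i)).
  apply: (@le_trans _ _ (fine (P (\big[setU/set0]_(i < n.+2) F i)))).
    apply: fine_probability_le; first exact: measurable_sup_deviation.
      by apply: bigsetU_measurable.
    move=> w [hw wb]; have [i iN hi] := sup_deviation_grid N0 e_eps Hn hw.
    by rewrite (bigD1 (Ordinal iN))//=; left.
  apply: (le_trans (fine_probability_bigsetU_le _ _ _ mF)).
  apply: (@le_trans _ _ (\sum_(i < n.+2)
      2 * expR (2 * \sum_(i < N) dev i - c * N%:R) * fine (P (bridge_event N)))).
    by apply: ler_sum => i _;
      apply: (bridge_deviation lam Hmarkov HC1 Hpos C0 D0 lCD (g01 i) e01 N0).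
  by rewrite sumr_const card_ord -[_ *+ n.+2]mulr_natl /K !mulrA.
have c4 : 0 < c / 4 by rewrite divr_gt0.
(* At level [c / 4], the doubled sum of deviations uses up at most half of the exponent [c * N]. *)
have /cvgrPdist_le/(_ _ c4)[N1 _ HN1] := cesaro Hlim.
apply/cvgrPdist_le => x x0.
(* From [exp y >= y] with [y = c / 2 * N], the bound [K * exp(- y)] is at most [K / y], hence at
   most [x] for such [N]. *)
pose N2 := Num.bound (K / (x * (c / 2))).
(* The successor excludes [N = 0] and matches the Cesaro mean, whose term of index [N] averages
   [N + 1] values. *)
exists (maxn N1 N2).+1 => // -[//|N] /=; rewrite ltnS geq_max => /andP[NN1 NN2].
have /andP[p0 p1] := bound N.+1 isT.
rewrite sub0r normrN ger0_norm//; apply: (le_trans p1).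
have hS : \sum_(i < N.+1) dev i <= c / 4 * N.+1%:R.
  have := HN1 N NN1; rewrite /= sub0r normrN => /(le_trans (ler_norm _)).
  by rewrite ler_pdivrMl ?ltr0Sn// /series/= big_mkord mulrC.
apply: (@le_trans _ _ (K * expR (- (c / 2 * N.+1%:R)))).
  by rewrite ler_wpM2l ?(ltW K0)// ler_expR; move: hS; move: (\sum_(i < _) _) => S; lra.
have y0 : 0 < c / 2 * N.+1%:R by rewrite !mulr_gt0 ?ltr0Sn.
rewrite expRN ler_pdivrMr ?expR_gt0//.
apply: (@le_trans _ _ (x * (c / 2 * N.+1%:R))); last first.
  by rewrite ler_wpM2l ?(ltW x0)// (le_trans _ (expR_ge1Dx _))// lerDr.
have xc0 : 0 < x * (c / 2) by rewrite mulr_gt0// divr_gt0.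
rewrite mulrA mulrC -ler_pdivrMr//.
apply: (@le_trans _ _ N2%:R); first by apply/ltW/archi_boundP/ltW; rewrite divr_gt0.
by rewrite ler_nat (leq_trans NN2).
Qed.
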